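(* There exists an infinite family $\mathcal{F}$ such that each $G\in\mathcal{F}$ is a topological $T_1$ metagroup which is compact, locally connected, and cannot be decomposed into an inverse continuous homomorphism system $S_G=\{G_j,\pi^j_i,\Lambda\}$ of topological metagroups $G_j$ with $\dim(G_j)<\infty$ for each $j\in\Lambda$.
   Context: A metagroup is a set $G$ with a single-valued binary operation $(a,b)\mapsto ab$ such that: (i) for all $a,b\in G$ there is a unique $x\in G$ with $ax=b$, denoted $x=a\setminus b=Div_l(a,b)$, and a unique $y\in G$ with $ya=b$, denoted $y=b/a=Div_r(a,b)$; (ii) there is $e\in G$ with $eg=ge=g$ for all $g\in G$; (iii) for all $a,b,c\in G$ one has $(ab)c=t(a,b,c)\,(a(bc))$ with some $t(a,b,c)\in\mathcal{C}(G)$. Here $\mathcal{C}(G)=Com(G)\cap N_l(G)\cap N_m(G)\cap N_r(G)$ is the center, where $Com(G)=\{a: ab=ba\ \forall b\in G\}$, $N_l(G)=\{a: (ab)c=a(bc)\ \forall b,c\in G\}$, $N_m(G)=\{a: (ba)c=b(ac)\ \forall b,c\in G\}$, $N_r(G)=\{a: (bc)a=b(ca)\ \forall b,c\in G\}$. A topological metagroup is a metagroup with a topology such that multiplication, $Div_l$ and $Div_r$ are jointly continuous maps $G\times G\to G$; it is called $T_1$ if it is $T_1$ as a topological space. Let $\Lambda$ be a directed set, let $G_j$ ($j\in\Lambda$) be topological metagroups, and let $\pi^j_i:G_j\to G_i$ be continuous homomorphisms for $i\le j$ in $\Lambda$, with $\pi^j_i\circ\pi^k_j=\pi^k_i$ for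 all $i\le j\le k$ and $\pi^i_i=\mathrm{id}_{G_i}$. Then $S=\{G_j,\pi^j_i,\Lambda\}$ is called an inverse continuous homomorphism system of topological metagroups. A topological metagroup $G$ is said to be decomposed into $S$ if $G$ is the (inverse, i.e. projective) limit of $S$, $G=\varprojlim S$. $\dim$ denotes the covering dimension. *)

(* Defs.v *)
From HB Require Import structures.
From mathcomp Require Import all_boot all_order.
From mathcomp Require Import all_classical topology.

Set Implicit Arguments.
Unset Strict Implicit.
Unset Printing Implicit Defensive.

Import Order.TTheory.

Local Open Scope classical_set_scope.
Local Open Scope group_scope.

Section center.
Variable G : magmaType.

Definition Com : set G := [set a | forall b, a * b = b * a].
Definition Nl : set G := [set a | forall b c, (a * b) * c = a * (b * c)].
Definition Nm : set G := [set a | forall b c, (b * a) * c = b * (a * c)].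
Definition Nr : set G := [set a | forall b c, (b * c) * a = b * (c * a)].

Definition mcenter : set G := Com `&` Nl `&` Nm `&` Nr.

End center.
Arguments mcenter : clear implicits.

(* [UMagma] carries the multiplication and the two-sided unit [1].  The
   equivalences below say that [ldiv a b] is the unique solution [x] of
   [a * x = b], and [rdiv b a] the unique solution [y] of [y * a = b]. *)
HB.mixin Record UMagma_isMetagroup G of UMagma G := {
  ldiv : G -> G -> G;
  rdiv : G -> G -> G;
  ldivP : forall a b x : G, a * x = b <-> x = ldiv a b;
  rdivP : forall a b y : G, y * a = b <-> y = rdiv b a;
  mulgA_center : forall a b c : G,
    exists2 t, mcenter G t & (a * b) * c = t * (a * (b * c))
}.

#[short(type="metagroupType")]
HB.structure Definition Metagroup := { G of UMagma G & UMagma_isMetagroup G }.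

HB.mixin Record Metagroup_isTopMetagroup G of Topological G & Metagroup G := {
  mulg_continuous : continuous (fun x : G * G => x.1 * x.2);
  ldiv_continuous : continuous (fun x : G * G => ldiv x.1 x.2);
  rdiv_continuous : continuous (fun x : G * G => rdiv x.1 x.2)
}.

#[short(type="topMetagroupType")]
HB.structure Definition TopMetagroup :=
  { G of Topological G & Metagroup G & Metagroup_isTopMetagroup G }.

Definition mhom (G H : magmaType) (f : G -> H) := {morph f : x y / x * y}.

Definition cont_hom (G H : topMetagroupType) (f : G -> H) :=
  mhom f /\ continuous f.

Definition top_iso (G H : topMetagroupType) :=
  exists (f : G -> H) (g : H -> G),
    [/\ cancel f g, cancel g f, cont_hom f & cont_hom g].

Section mhom_theory.
Variables (G H : metagroupType) (f : G -> H).
Hypothesis fM : mhom f.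

Lemma mhom_ldiv a b : f (ldiv a b) = ldiv (f a) (f b).
Proof. by apply/ldivP; rewrite -fM; congr f; apply/ldivP. Qed.

Lemma mhom_rdiv a b : f (rdiv a b) = rdiv (f a) (f b).
Proof. by apply/rdivP; rewrite -fM; congr f; apply/rdivP. Qed.

Lemma mhom1 : f 1 = 1.
Proof.
have /ldivP -> : f 1 * f 1 = f 1 by rewrite -fM mulg1.
by apply/esym/ldivP; rewrite mulg1.
Qed.

End mhom_theory.

(* The order on the index set is a preorder: antisymmetry is not required of a
   directed set. *)
Record inverse_system := InverseSystem {
  sys_disp : Order.disp_t;
  sys_index : preorderType sys_disp;
  sys_inhabited : inhabited sys_index;
  sys_directed : forall i j : sys_index, exists k, (i <= k)%O /\ (j <= k)%O;
  sys_obj : sys_index -> topMetagroupType;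
  sys_map : forall i j : sys_index, (i <= j)%O -> sys_obj j -> sys_obj i;
  sys_map_hom : forall (i j : sys_index) (ij : (i <= j)%O),
    cont_hom (sys_map ij);
  sys_map_id : forall (i : sys_index) (ii : (i <= i)%O) (x : sys_obj i),
    sys_map ii x = x;
  sys_map_comp : forall (i j k : sys_index)
    (ij : (i <= j)%O) (jk : (j <= k)%O) (ik : (i <= k)%O) (x : sys_obj k),
    sys_map ij (sys_map jk x) = sys_map ik x
}.

(* The inverse limit: the threads, with componentwise operations and the
   topology induced by the product topology. *)
Definition threads (S : inverse_system) : set (prod_topology (@sys_obj S)) :=
  [set x | forall (i j : sys_index S) (ij : (i <= j)%O), sys_map ij (x j) = x i].

Definition inverse_limit (S : inverse_system) : Type := set_type (@threads S).

Section inverse_limit.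
Variable S : inverse_system.
Local Notation L := (inverse_limit S).

HB.instance Definition _ := Topological.copy L (set_type (@threads S)).

Definition coord (x : L) (j : sys_index S) : sys_obj j := set_val x j.

Lemma coordP (x : L) (i j : sys_index S) (ij : (i <= j)%O) :
  sys_map ij (coord x j) = coord x i.
Proof. by have := set_valP x; apply. Qed.

Definition mkL (x : forall j : sys_index S, sys_obj j) (xP : threads x) : L :=
  exist _ (x : prod_topology _) (mem_set xP).

Lemma coord_mkL x (xP : threads x) j : coord (mkL xP) j = x j.
Proof. by rewrite /coord set_valE. Qed.

Lemma coord_inj (x y : L) : (forall j, coord x j = coord y j) -> x = y.
Proof.
move=> xy; apply: eq_sig_hprop => [? ? ?|]; first exact: bool_irrelevance.
by apply: functional_extensionality_dep => j; have := xy j; rewrite /coord set_valE.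
Qed.

Lemma coord_continuous j : continuous (coord ^~ j).
Proof.
move=> x; apply: (@continuous_comp _ _ _ (set_val : L -> prod_topology _) (proj j)).
  exact: initial_continuous.
exact: proj_continuous.
Qed.

Lemma continuous_coord (T : topologicalType) (f : T -> L) :
  (forall j, continuous (fun t => coord (f t) j)) -> continuous f.
Proof.
move=> fc; apply: continuous_comp_initial => t.
by apply/cvg_sup => j; apply: (@continuous_comp_initial) t; exact: fc.
Qed.

Lemma threads_mul (x y : L) :
  threads (fun j : sys_index S => coord x j * coord y j).
Proof. by move=> i j ij; rewrite (sys_map_hom ij).1 !coordP. Qed.

Lemma threads_ldiv (x y : L) :
  threads (fun j : sys_index S => ldiv (coord x j) (coord y j)).
Proof. by move=> i j ij; rewrite (mhom_ldiv (sys_map_hom ij).1) !coordP. Qed.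

Lemma threads_rdiv (x y : L) :
  threads (fun j : sys_index S => rdiv (coord x j) (coord y j)).
Proof. by move=> i j ij; rewrite (mhom_rdiv (sys_map_hom ij).1) !coordP. Qed.

Lemma threads_one : threads (fun j : sys_index S => 1 : sys_obj j).
Proof. by move=> i j ij; rewrite (mhom1 (sys_map_hom ij).1). Qed.

Definition lim_mul (x y : L) : L := mkL (threads_mul x y).
Definition lim_ldiv (x y : L) : L := mkL (threads_ldiv x y).
Definition lim_rdiv (x y : L) : L := mkL (threads_rdiv x y).
Definition lim_one : L := mkL threads_one.

Let lim_mul1g : left_id lim_one lim_mul.
Proof. by move=> x; apply: coord_inj => j; rewrite !coord_mkL mul1g. Qed.

Let lim_mulg1 : right_id lim_one lim_mul.
Proof. by move=> x; apply: coord_inj => j; rewrite !coord_mkL mulg1. Qed.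

HB.instance Definition _ := hasMul.Build L lim_mul.
HB.instance Definition _ := Magma_isUMagma.Build L lim_mul1g lim_mulg1.

Lemma coord_mul (x y : L) j : coord (x * y) j = coord x j * coord y j.
Proof. exact: coord_mkL. Qed.

Let lim_ldivP (a b x : L) : a * x = b <-> x = lim_ldiv a b.
Proof.
split=> [<-|->]; apply: coord_inj => j; rewrite ?coord_mul coord_mkL.
  by apply/ldivP; rewrite coord_mul.
exact/ldivP.
Qed.

Let lim_rdivP (a b y : L) : y * a = b <-> y = lim_rdiv b a.
Proof.
split=> [<-|->]; apply: coord_inj => j; rewrite ?coord_mul coord_mkL.
  by apply/rdivP; rewrite coord_mul.
exact/rdivP.
Qed.

Let lim_mulgA_center (a b c : L) :
  exists2 t, mcenter L t & (a * b) * c = t * (a * (b * c)).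
Proof.
pose t := lim_rdiv ((a * b) * c) (a * (b * c)).
have tE j : mcenter (sys_obj j) (coord t j).
  have [u uC uE] := mulgA_center (coord a j) (coord b j) (coord c j).
  suff -> : coord t j = u by [].
  by rewrite coord_mkL !coord_mul; apply/esym/rdivP; rewrite uE.
exists t; last by apply/esym/lim_rdivP.
split; [split; [split|]|]; move=> x; [| move=> y ..]; apply: coord_inj => j;
  rewrite !coord_mul; by have [[[tC tl] tm] tr] := tE j.
Qed.

HB.instance Definition _ := UMagma_isMetagroup.Build L
  lim_ldivP lim_rdivP lim_mulgA_center.

Let lim_op_continuous (op : L -> L -> L)
    (opj : forall j : sys_index S, sys_obj j -> sys_obj j -> sys_obj j) :
  (forall x y j, coord (op x y) j = opj j (coord x j) (coord y j)) ->
  (forall j, continuous (fun x : sys_obj j * sys_obj j => opj j x.1 x.2)) ->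
  continuous (fun x : L * L => op x.1 x.2).
Proof.
move=> opE opc; apply: continuous_coord => j.
under [X in continuous X]funext => x do rewrite opE.
move=> x.
apply: (@continuous_comp _ _ _ (fun x : L * L => (coord x.1 j, coord x.2 j))
          (fun x => opj j x.1 x.2)); last exact: opc.
apply: cvg_pair; apply: (continuous_comp _ (@coord_continuous j _)).
  exact: cvg_fst.
exact: cvg_snd.
Qed.

Let lim_mulg_continuous : continuous (fun x : L * L => x.1 * x.2).
Proof.
apply: (@lim_op_continuous _ (fun j x y => x * y)) => [x y j|j].
  exact: coord_mul.
exact: mulg_continuous.
Qed.

Let lim_ldiv_continuous : continuous (fun x : L * L => ldiv x.1 x.2).
Proof.
apply: (@lim_op_continuous _ (fun j x y => ldiv x y)) => [x y j|j].
  exact: coord_mkL.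
exact: ldiv_continuous.
Qed.

Let lim_rdiv_continuous : continuous (fun x : L * L => rdiv x.1 x.2).
Proof.
apply: (@lim_op_continuous _ (fun j x y => rdiv x y)) => [x y j|j].
  exact: coord_mkL.
exact: rdiv_continuous.
Qed.

HB.instance Definition _ := Metagroup_isTopMetagroup.Build L
  lim_mulg_continuous lim_ldiv_continuous lim_rdiv_continuous.

End inverse_limit.

Definition decomposed (G : topMetagroupType) (S : inverse_system) :=
  top_iso G (inverse_limit S).

Definition locally_connected (T : topologicalType) :=
  basis [set V : set T | open V /\ connected V].

(* Covering dimension: every finite open cover has a finite open refinement of
   order at most [n], i.e. no point lies in more than [n + 1] of its members. *)
Definition covering_dim_le (T : topologicalType) (n : nat) :=
  forall U : set (set T), finite_set U -> U `<=` open -> cover U id = setT ->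
  exists V : set (set T), [/\ finite_set V, V `<=` open, cover V id = setT,
    (forall B, V B -> exists2 A, U A & B `<=` A) &
    forall x, ([set B | V B /\ B x] #<= `I_n.+1)%card].

Definition finite_covering_dim (T : topologicalType) :=
  exists n, covering_dim_le T n.

(* Main.v *)
Require Import Defs.
From HB Require Import structures.
From mathcomp Require Import all_boot all_order all_algebra ring lra.
From mathcomp Require Import all_classical reals interval_inference topology.
From mathcomp Require Import normedtype Rstruct.

(* Let T be the circle.  The metagroup G is the extension of the infinite torus
   T^nat by T with product
     (a, x)(b, y) = (a + b + f(x, y), x + y),
   where f depends on infinitely many coordinates and is so asymmetric that
   f(w, z) = f(z, w) for all z forces w = 0.  Suppose that G is the limit of
   the G_j.  As T has no small subgroups, for large j the map G -> G_j is
   injective on the central circle.  The commutator with an element of its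
   kernel is a central element of the kernel, hence trivial, so the kernel is
   contained in T, hence trivial.  Thus G_j contains cubes of all dimensions,
   and Lebesgue's covering theorem, deduced from a cubical Sperner lemma, shows
   that dim G_j is infinite.  As no separation axiom is assumed of G_j, the
   kernel here is the set of elements whose image is topologically
   indistinguishable from 1.  Products of G with finite cyclic groups, told
   apart by their number of connected components, give the infinite family. *)

Import Order.TTheory GRing.Theory Num.Theory numFieldNormedType.Exports.

Local Open Scope classical_set_scope.

(** * A cubical Sperner lemma *)

Section cubical_sperner.

(* A cell of the cubical grid is the sequence of its doubled coordinates: an
   even entry [2a] is the point [a], an odd entry [2a + 1] the interval
   [[a, a + 1]].  The entries of its vertices are the [x] with
   [a./2 <= x <= uphalf a]. *)
Fixpoint vertices (c : seq nat) : seq (seq nat) :=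
  if c is a :: c' then
    [seq x :: v | x <- [:: a./2; uphalf a], v <- vertices c']
  else [:: [::]].

(** The coboundary modulo 2 of the cochain [P]: a facet of a cell arises by replacing one odd entry
    by one of its two even neighbours. *)
Fixpoint cobound (P : seq nat -> bool) (c : seq nat) : bool :=
  if c is a :: c' then
    (odd a && (P (a.-1 :: c') (+) P (a.+1 :: c')))
      (+) cobound (fun s => P (a :: s)) c'
  else false.

(** The integral modulo 2 of the cochain [P] over the grid of side [k]: its top-dimensional cells
    are those with all entries odd. *)
Fixpoint cellsum (k d : nat) (P : seq nat -> bool) : bool :=
  if d is d'.+1 then
    \big[addb/false]_(x < k) cellsum k d' (fun s => P (x.*2.+1 :: s))
  else P [::].

(* Modulo 2, [sperner d j l c] counts the flags [c = c_0 > ... > c_d] of cells,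
   each of codimension one in the previous one, such that the labels of all
   vertices of [c_i] are at least [j + i].  If the labels of [c] exceed [j],
   these flags cancel in pairs, because [cobound] has square zero. *)
Fixpoint sperner (d j : nat) (l : seq nat -> nat) (c : seq nat) : bool :=
  all (fun v => j <= l v) (vertices c) &&
  (if d is d'.+1 then cobound (sperner d' j.+1 l) c else true).

Lemma eq_cobound P Q c : P =1 Q -> cobound P c = cobound Q c.
Proof.
elim: c P Q => [//|a c IH] P Q PQ /=.
by rewrite !PQ (IH _ (fun s => Q (a :: s))).
Qed.

Lemma coboundD P Q c :
  cobound (fun s => P s (+) Q s) c = cobound P c (+) cobound Q c.
Proof.
elim: c P Q => [//|a c IH] P Q /=; rewrite IH.
by case: (odd a) => /=; [case: (P (a.-1 :: c)); case: (P (a.+1 :: c));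
  case: (Q (a.-1 :: c)); case: (Q (a.+1 :: c)) | ];
  case: (cobound _ c); case: (cobound _ c).
Qed.

(** A face of codimension two is reached by lowering two odd entries in either order, so each term
    occurs twice. *)
Lemma cobound_cobound P c : cobound (cobound P) c = false.
Proof.
elim: c P => [//|a c IH] P /=; case: (boolP (odd a)) => oa /=; last first.
  by rewrite (eq_cobound _ (cobound (fun s => P (a :: s)))) ?IH.
have [oa1 oa2] : odd a.-1 = false /\ odd a.+1 = false.
  by case: a oa => //= a; case: (odd a).
rewrite oa1 /= coboundD [X in _ (+) (_ (+) X)]IH addbF.
by rewrite coboundD addbb.
Qed.

Fixpoint facet (c c' : seq nat) : bool :=
  match c, c' with
  | a :: s, a' :: s' =>
      [&& odd a, (a' == a.-1) || (a' == a.+1) & s' == s] || ((a' == a) && facet s s')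
  | _, _ => false
  end.

Lemma eq_in_cobound P Q c :
  (forall c', facet c c' -> P c' = Q c') -> cobound P c = cobound Q c.
Proof.
elim: c P Q => [//|a c IH] P Q PQ /=; congr (_ (+) _).
  by case: (boolP (odd a)) => //= oa; rewrite !PQ //= oa !eqxx ?orbT.
by apply: IH => c' cc'; apply: PQ; rewrite /= eqxx cc' orbT.
Qed.

Lemma cobound_neq0 P c : cobound P c -> exists2 c', facet c c' & P c'.
Proof.
apply: contraPP => nP.
rewrite (@eq_in_cobound P (fun=> false)) => [|c' cc'].
  by elim: (c) => //= a s IH; rewrite andbF.
by apply/negP => Pc'; apply: nP; exists c'.
Qed.

Lemma facet_vertices c c' : facet c c' -> {subset vertices c' <= vertices c}.
Proof.
elim: c c' => [//|a c IH] [//|a' c'] /=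
  /orP[/and3P[oa aa' /eqP ->]|/andP[/eqP -> cc']]; last first.
  move=> v; rewrite !cats0 !mem_cat => /orP[|] /mapP[w /(IH _ cc') wc ->];
  by rewrite map_f ?orbT.
have sub : {subset [:: a'./2; uphalf a'] <= [:: a./2; uphalf a]}.
  move: aa'; rewrite -(odd_double_half a) oa /= => /orP[] /eqP -> x;
  by rewrite ?doubleK ?uphalf_double /= ?uphalf_double ?doubleK ?half_double !inE
    => /orP[] /eqP ->; rewrite eqxx ?orbT.
move=> v; rewrite !cats0 !mem_cat.
by case/orP => /mapP[w wc ->]; [have := sub a'./2 | have := sub (uphalf a')];
   rewrite !inE eqxx ?orbT => /(_ isT) /orP[|] /eqP ->; rewrite map_f ?orbT.
Qed.

Lemma vertices_neq0 c : exists v, v \in vertices c.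
Proof.
elim: c => [|a c [v vc]]; first by exists [::]; rewrite inE.
by exists (a./2 :: v); rewrite /= mem_cat map_f.
Qed.

(** A nonzero value of [sperner] passes to some facet with [j] raised by one, which by induction
    carries all labels above [j]. The label [j] itself must occur, since otherwise the flags
    cancel. *)
Lemma sperner_labels d j l c (lmax : forall v, v \in vertices c -> l v <= j + d) :
  sperner d j l c -> forall i, j <= i <= j + d ->
  exists2 v, v \in vertices c & l v = i.
Proof.
elim: d j c lmax => [|d IH] j c lmax /=.
  rewrite andbT => /allP lc i; rewrite addn0 -eqn_leq => /eqP <-.
  have [v vc] := vertices_neq0 c; exists v => //.
  by apply/eqP; rewrite eqn_leq lc // andbT; have := lmax v vc; rewrite addn0.
move=> /andP[/allP lc dc] i /andP[ji id].
have [ij|ij] := eqVneq i j; last first.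
  have [c' cc' Sc'] := cobound_neq0 _ _ dc.
  have [v vc' <-] : exists2 v, v \in vertices c' & l v = i.
    apply: (IH j.+1 c') => //; last by rewrite addSnnS id ltn_neqAle eq_sym ij ji.
    by move=> v /(facet_vertices _ _ cc') /lmax; rewrite addSnnS.
  by exists v => //; exact: facet_vertices vc'.
rewrite {}ij {i ji id}.
have [/hasP[v vc /eqP lv]|/hasPn lj] := boolP (has (fun v => l v == j) (vertices c)).
  by exists v.
have {}lc v : v \in vertices c -> j < l v.
  by move=> vc; rewrite ltn_neqAle eq_sym lj // lc.
(* When all labels of [c] exceed [j], the label test on the facets is automatic, so a coboundary is
   applied twice. For [d = 0] it is applied to the constant [true], and opposite facets cancel. *)
suff : cobound (sperner d j.+1 l) c = false by rewrite dc.
case: d {IH lmax dc} => [|d].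
  rewrite (@eq_in_cobound _ (fun=> true)) => [|c' cc'] /=; last first.
    by rewrite andbT; apply/allP => v /(facet_vertices _ _ cc') /lc.
  by elim: {lc lj} c => //= a c ->; rewrite andbF.
rewrite -(cobound_cobound (sperner d j.+2 l) c); apply: eq_in_cobound => c' cc' /=.
rewrite [X in X && _](_ : _ = true) //.
by apply/allP => v /(facet_vertices _ _ cc') /lc.
Qed.

Lemma eq_cellsum k d P Q : (forall s, size s = d -> all odd s -> P s = Q s) ->
  cellsum k d P = cellsum k d Q.
Proof.
elim: d P Q => [|d IH] P Q PQ /=; first exact: PQ.
apply: eq_bigr => x _; apply: IH => s sd os.
by apply: PQ => /=; rewrite ?sd ?odd_double.
Qed.

Lemma cellsum0 k d : cellsum k d (fun=> false) = false.
Proof. by elim: d => //= d ->; rewrite big1_eq. Qed.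

Lemma cellsumD k d P Q :
  cellsum k d (fun s => P s (+) Q s) = cellsum k d P (+) cellsum k d Q.
Proof.
by elim: d P Q => //= d IH P Q; rewrite -big_split; apply: eq_bigr => x _; exact: IH.
Qed.

Lemma telescope_addb k (f : nat -> bool) :
  \big[addb/false]_(x < k) (f x (+) f x.+1) = f 0 (+) f k.
Proof.
elim: k => [|k IH]; first by rewrite big_ord0 addbb.
by rewrite big_ord_recr /= IH addbA addbK.
Qed.

(** Stokes' formula in the first coordinate: the walls orthogonal to it telescope to the two outer
    ones, and the remaining coordinates keep their coboundary. *)
Lemma stokes k d P : cellsum k d.+1 (cobound P) =
  (cellsum k d (fun s => P (0 :: s)) (+) cellsum k d (fun s => P (k.*2 :: s)))
  (+) \big[addb/false]_(x < k) cellsum k d (cobound (fun s => P (x.*2.+1 :: s))).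
Proof.
rewrite -(telescope_addb k (fun x => cellsum k d (fun s => P (x.*2 :: s)))).
rewrite -big_split; apply: eq_bigr => x _ /=; rewrite -!cellsumD.
by apply: eq_cellsum => s _ _; rewrite odd_double.
Qed.

Lemma stokes0 k d P :
  (forall s, size s = d -> has (fun a => (a == 0) || (a == k.*2)) s -> P s = false) ->
  cellsum k d (cobound P) = false.
Proof.
elim: d P => [//|d IH] P P0; rewrite stokes.
rewrite (@eq_cellsum k d _ (fun=> false)) => [|s sd _]; last by rewrite P0 /= ?sd.
rewrite (@eq_cellsum k d (fun s => P (k.*2 :: s)) (fun=> false)) => [|s sd _];
  last first.
  by rewrite P0 /= ?sd ?eqxx ?orbT.
rewrite cellsum0 big1 // => x _; apply: IH => s sd sb.
by rewrite P0 /= ?sd // sb orbT.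
Qed.

(** An even first entry has no facets of its own, so the facets of [0 :: s] are those of [s]; its
    vertices are merely listed twice. *)
Lemma sperner_cons0 d j l s :
  sperner d j l (0 :: s) = sperner d j (fun v => l (0 :: v)) s.
Proof.
elim: d j s => [|d IH] j s /=.
  by rewrite cats0 all_cat !all_map andbb.
rewrite cats0 all_cat !all_map andbb; congr (_ && _).
exact: eq_cobound.
Qed.

Lemma nth_vertices c v i : v \in vertices c ->
  size v = size c /\ ((nth 0 c i)./2 <= nth 0 v i <= uphalf (nth 0 c i)).
Proof.
elim: c v i => [|a c IH] v i /=; first by rewrite inE => /eqP ->; rewrite !nth_nil.
have aa : a./2 <= uphalf a by rewrite uphalf_half leq_addl.
rewrite cats0 mem_cat => /orP[] /mapP[w wc ->] /=;
by have [sw _] := IH _ 0 wc; rewrite sw; case: i => [|i] //=;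
   rewrite ?aa ?leqnn //; have [] := IH _ i wc.
Qed.

(** Induction on the dimension. By [stokes] only the outer walls count. The wall where the first
    coordinate is [0] avoids the label [j] and falls under the induction hypothesis with [j.+1].
    Every other wall misses one of the labels [j.+1], ..., [j.+1 + d], so [sperner] vanishes on it
    by [sperner_labels]. *)
Lemma sperner_odd k d j l : 0 < k ->
  (forall v, size v = d -> j <= l v <= j + d) ->
  (forall v i, size v = d -> i < d -> nth 0 v i = 0 -> l v != j + i) ->
  (forall v i, size v = d -> i < d -> nth 0 v i = k -> l v != j + i.+1) ->
  cellsum k d (sperner d j l).
Proof.
move=> k0; elim: d j l => [|d IH] j l lb l0 lk.
  by rewrite /= !andbT; have /andP[] := lb [::] erefl.
rewrite (@eq_cellsum _ _ _ (cobound (sperner d j.+1 l))); last first.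
  move=> s sd _ /=; rewrite [X in X && _](_ : _ = true) //; apply/allP => v vs.
  by have [vd _] := nth_vertices _ _ 0 vs; have /andP[] := lb v (etrans vd sd).
have lb' v : size v = d.+1 -> l v <= j.+1 + d by rewrite addSnnS => /lb /andP[].
have vanish s e : size s = d.+1 -> j < e <= j.+1 + d ->
    (forall v, v \in vertices s -> l v != e) -> sperner d j.+1 l s = false.
  move=> sd je le; apply/negP => Ss.
  have lmax v : v \in vertices s -> l v <= j.+1 + d.
    by move=> /(nth_vertices _ _ 0)[vs _]; exact/lb'/(etrans vs).
  have [v vs lv] := sperner_labels _ _ _ _ lmax Ss _ je.
  by have := le _ vs; rewrite lv eqxx.
have nthE s v i b : v \in vertices s -> nth 0 s i = b.*2 -> nth 0 v i = b.
  move=> /(nth_vertices _ _ i)[_] /[swap] ->.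
  by rewrite uphalf_double doubleK -eqn_leq => /eqP.
rewrite stokes (@eq_cellsum k d _ (sperner d j.+1 (fun v => l (0 :: v)))); last first.
  by move=> s _ _; exact: sperner_cons0.
rewrite IH; last first.
- by move=> v i vd id vi; rewrite addSnnS (lk (0 :: v) i.+1) //= vd.
- by move=> v i vd id vi; rewrite addSnnS (l0 (0 :: v) i.+1) //= vd.
- move=> v vd; have vd' : size (0 :: v) = d.+1 by rewrite /= vd.
  rewrite lb' // andbT ltn_neqAle eq_sym -{1}[j]addn0 l0 //.
  by have /andP[] := lb _ vd'.
rewrite (@eq_cellsum k d _ (fun=> false)) => [|s sd _]; last first.
  apply: (vanish (k.*2 :: s) j.+1) => [||v vs]; rewrite ?ltnS ?leqnn ?leq_addr //=.
    by rewrite sd.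
  have [vd _] := nth_vertices _ _ 0 vs.
  by rewrite -addn1 lk ?(nthE _ _ 0 k vs) // vd /= sd.
rewrite cellsum0 big1 // => x _; apply: stokes0 => s sd /(has_nthP 0)[i].
rewrite sd => id /orP[] /eqP si.
  apply: (vanish (x.*2.+1 :: s) (j + i.+1)) => [||v vs].
  - by rewrite /= sd.
  - by rewrite addSnnS leq_add2l ltnS (ltnW id) addnS ltnS leq_addr.
  have [vd _] := nth_vertices _ _ 0 vs.
  by rewrite l0 ?(nthE _ _ i.+1 0 vs) // vd /= sd.
apply: (vanish (x.*2.+1 :: s) (j + i.+2)) => [||v vs].
- by rewrite /= sd.
- by rewrite addSnnS leq_add2l ltnS id addnS ltnS leq_addr.
have [vd _] := nth_vertices _ _ 0 vs.
by rewrite lk ?(nthE _ _ i.+1 k vs) // vd /= sd.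
Qed.

Lemma cellsum_neq0 k d P : cellsum k d P ->
  exists c, [/\ size c = d, all odd c, all (fun a => a < k.*2) c & P c].
Proof.
elim: d P => [|d IH] P /=; first by exists [::].
case: (pselect (exists x : 'I_k, cellsum k d (fun s => P (x.*2.+1 :: s)))).
  move=> [x /IH[c [cd co ck Pc]]] _; exists (x.*2.+1 :: c); split=> //=.
  - by rewrite cd.
  - by rewrite odd_double.
  - by rewrite ck andbT ltn_Sdouble.
by move=> nx; rewrite big1 // => x _; apply/negP => Px; apply: nx; exists x.
Qed.

Theorem cubical_sperner k d (l : seq nat -> nat) : 0 < k ->
  (forall v, size v = d -> l v <= d) ->
  (forall v i, size v = d -> i < d -> nth 0 v i = 0 -> l v != i) ->
  (forall v i, size v = d -> i < d -> nth 0 v i = k -> l v != i.+1) ->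
  exists c, forall j, j <= d -> exists v,
    [/\ size v = d, l v = j & forall i, i < d ->
      nth 0 c i <= nth 0 v i <= (nth 0 c i).+1 /\ nth 0 v i <= k].
Proof.
move=> k0 lb l0 lk.
have [] := @cellsum_neq0 k d (sperner d 0 l); first exact: sperner_odd.
(* All entries of the cell are odd, so halving them gives the lower corner of a unit cube. *)
move=> c [cd co ck Sc]; exists (map half c) => j jd.
have [v vc lvj] : exists2 v, v \in vertices c & l v = j.
  apply: sperner_labels Sc _ _ => // v vc; apply: lb.
  by have [-> _] := nth_vertices _ _ 0 vc.
have [vd _] := nth_vertices _ _ 0 vc.
exists v; rewrite vd cd; split=> // i id; have [_] := nth_vertices _ _ i vc.
rewrite (nth_map 0) ?cd // uphalf_half.
have /(allP co) -> : nth 0 c i \in c by rewrite mem_nth ?cd.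
rewrite add1n => /andP[-> vi]; split=> //; apply: leq_trans vi _.
have /(allP ck) : nth 0 c i \in c by rewrite mem_nth ?cd.
by rewrite ltn_half_double.
Qed.

End cubical_sperner.

Set Implicit Arguments.
Unset Strict Implicit.
Unset Printing Implicit Defensive.

(** * Covering dimension of topological metagroups *)

Lemma continuous_pair (A B C D : topologicalType) (op : B * C -> D)
    (f : A -> B) (g : A -> C) :
  continuous op -> continuous f -> continuous g ->
  continuous (fun x => op (f x, g x)).
Proof.
move=> opc fc gc x; apply: (@continuous_comp _ _ _ (fun x => (f x, g x)) op).
  by apply: cvg_pair; [exact: fc|exact: gc].
exact: opc.
Qed.

(** * Indistinguishable points and separation in topological metagroups *)

Section indistinguishable.

(** The specialization preorder, which takes the place of equality in spaces without separation
    axioms. On topological metagroups it is symmetric by [indist_sym]. *)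
Definition indist (T : topologicalType) (x y : T) :=
  forall U : set T, open U -> U x -> U y.

Lemma indist_continuous (S T : topologicalType) (f : S -> T) x y :
  continuous f -> indist x y -> indist (f x) (f y).
Proof.
move=> /continuousP fc xy U oU Ufx; apply: (xy (f @^-1` U)) => //.
exact: fc.
Qed.

Lemma indist_trans (T : topologicalType) (x y z : T) :
  indist x y -> indist y z -> indist x z.
Proof. by move=> xy yz U oU Ux; apply: yz => //; exact: xy. Qed.

Variable H : topMetagroupType.
Local Open Scope group_scope.
Implicit Types x y z : H.

Lemma ldivK x y : x * ldiv x y = y. Proof. exact/ldivP. Qed.
Lemma rdivK x y : rdiv y x * x = y. Proof. exact/rdivP. Qed.
Lemma ldivxx x : ldiv x x = 1.
Proof. by apply/esym/ldivP; rewrite mulg1. Qed.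
Lemma ldiv1 x : ldiv 1 x = x.
Proof. by apply/esym/ldivP; rewrite mul1g. Qed.

Lemma mull_continuous x : continuous (fun y => x * y).
Proof.
exact: (continuous_pair (@mulg_continuous H) (fun=> cvg_cst _) (fun=> cvg_id)).
Qed.

Lemma mulr_continuous x : continuous (fun y => y * x).
Proof.
exact: (continuous_pair (@mulg_continuous H) (fun=> cvg_id) (fun=> cvg_cst _)).
Qed.

Lemma ldivl_continuous x : continuous (fun y => ldiv x y).
Proof.
exact: (continuous_pair (@ldiv_continuous H) (fun=> cvg_cst _) (fun=> cvg_id)).
Qed.

Lemma ldivr_continuous x : continuous (fun y => ldiv y x).
Proof.
exact: (continuous_pair (@ldiv_continuous H) (fun=> cvg_id) (fun=> cvg_cst _)).
Qed.

Lemma rdivr_continuous x : continuous (fun y => rdiv y x).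
Proof.
exact: (continuous_pair (@rdiv_continuous H) (fun=> cvg_id) (fun=> cvg_cst _)).
Qed.

(* The homeomorphism [z |-> (x / z) y] sends [x] to [y] and [y] to [x / y * y = x]. *)
Lemma indist_sym x y : indist x y -> indist y x.
Proof.
have c : continuous (fun z => rdiv x z * y).
  move=> z; apply: (@continuous_comp _ _ _ (rdiv x) (fun z => z * y)).
    exact: (continuous_pair (@rdiv_continuous H) (fun=> cvg_cst _) (fun=> cvg_id)).
  exact: mulr_continuous.
move=> /(indist_continuous c); rewrite rdivK.
by have /rdivP <- : 1 * x = x := mul1g x; rewrite mul1g.
Qed.

(** As for topological groups: neighbourhoods [A] and [B] are chosen so that [ldiv] maps [A * B]
    into an open set avoiding [1]; a common point [z] would give [ldiv z z = 1]. *)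
Lemma open_separated x y : ~ indist x y -> exists A B : set H,
  [/\ open_nbhs x A, open_nbhs y B & forall z, A z -> B z -> False].
Proof.
move=> /existsNP[U] /not_implyP[oU] /not_implyP[Ux nUy].
(* The map [z |-> x * ldiv z w] sends [w] to [x] and [1] to [y], so it turns [U] into an open set
   containing [w] but not [1]. *)
pose w := ldiv x y; pose U1 := (fun z => x * z) @^-1` U.
pose U2 := (fun z => ldiv z w) @^-1` U1.
have oU2 : open U2.
  apply: open_comp => [? _|]; first exact: ldivr_continuous.
  by apply: open_comp => [? _|//]; exact: mull_continuous.
have U2w : U2 w by rewrite /U2 /U1 /= ldivxx mulg1.
have nU21 : ~ U2 1 by rewrite /U2 /U1 /= ldiv1 ldivK.
have [[A B] /= [nA nB] AB] :=
  @ldiv_continuous H (x, y) U2 (open_nbhs_nbhs (conj oU2 U2w)).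
exists A^°, B^°; split; rewrite /open_nbhs; do ?split;
  do ?exact: open_interior; do ?by [].
move=> z /interior_subset Az /interior_subset Bz.
by have := AB (z, z) (conj Az Bz); rewrite /= ldivxx.
Qed.

Lemma closure_compact_image (X : topologicalType) (q : X -> H) (K : set X) z :
  continuous q -> compact K -> closure (q @` K) z ->
  exists2 x, K x & indist (q x) z.
Proof.
move=> qc /compact_near_coveringP Kc clz; apply: contrapT => nK.
suff : \near z, K `<=` (fun x : X => q x <> z).
  by move=> /clz[_ [[x Kx <-]]] /(_ _ Kx).
apply: Kc => x Kx; have /open_separated[A [B [[oA Ax] zB AB]]] : ~ indist (q x) z.
  by move=> xz; apply: nK; exists x.
exists (q @^-1` A, B) => /=; last first.
  by move=> [a b] /= [Aa Bb] ab; apply: (AB b) => //; rewrite -ab.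
by split; [apply: qc; exact: open_nbhs_nbhs|exact: open_nbhs_nbhs].
Qed.

End indistinguishable.

(** * Lebesgue's covering theorem for cubes mapped into a topological metagroup *)

Section dimension.
Variables (R : realType) (m : nat).
Local Open Scope ring_scope.

Definition cube : set 'rV[R]_m := [set v | forall i, 0 <= v ord0 i <= 1].
(** The index is a natural number rather than an ordinal, so that faces of index at least [m] make
    sense and are empty. *)
Definition lface (i : nat) : set 'rV[R]_m :=
  cube `&` [set v | exists2 j : 'I_m, j = i :> nat & v ord0 j = 0].
Definition rface (i : nat) : set 'rV[R]_m :=
  cube `&` [set v | exists2 j : 'I_m, j = i :> nat & v ord0 j = 1].

Lemma cube_compact : compact cube.
Proof.
apply: (@rV_compact R m (fun=> [set x | 0 <= x <= 1])) => i.
rewrite (_ : mkset _ = `[0, 1]%classic); first exact: segment_compact.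
by apply/seteqP; split => x /=; rewrite in_itv.
Qed.

Lemma coord_closed (j : 'I_m) (a : R) : closed [set v : 'rV[R]_m | v ord0 j = a].
Proof.
apply: (@preimage_closed _ _ (fun v : 'rV[R]_m => v ord0 j) [set a]).
  by move=> v _; exact: matrix_normedtype.coord_continuous.
exact: closed_eq.
Qed.

Lemma face_compact (i : nat) (a : R) :
  compact (cube `&` [set v | exists2 j : 'I_m, j = i :> nat & v ord0 j = a]).
Proof.
have [im|im] := ltnP i m; last first.
  rewrite (_ : _ `&` _ = set0); first exact: compact0.
  by rewrite -subset0 => v [_ [j ji]]; have := ltn_ord j; rewrite ji ltnNge im.
apply: compact_closedI; first exact: cube_compact.
rewrite (_ : mkset _ = [set v | v ord0 (Ordinal im) = a]); first exact: coord_closed.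
apply/seteqP; split=> v /=; last by exists (Ordinal im).
by case=> j ji; have -> : Ordinal im = j by exact: val_inj.
Qed.

Lemma lebesgue_number (T : topologicalType) (q : 'rV[R]_m -> T) (V : set (set T)) :
  continuous q -> V `<=` open -> cover V id = setT ->
  \forall k \near \oo, forall x, cube x ->
    exists2 B, V B & forall y, ball x k.+1%:R^-1 y -> B (q y).
Proof.
move=> qc oV cV.
have /compact_near_coveringP := cube_compact; apply => x cx.
have [B VB Bqx] : cover V id (q x) by rewrite cV.
have /nbhs_ballP[e e0 eB] : nbhs x (q @^-1` B).
  by apply: qc; apply: open_nbhs_nbhs; split=> //; exact: oV.
have e20 : 0 < e / 2 by rewrite divr_gt0.
exists (ball x (e / 2), [set k | k.+1%:R^-1 < e / 2]).
  by split=> /=; [exact: nbhsx_ballx|exact: near_infty_natSinv_lt (PosNum e20)].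
move=> [y k] /= [xy ke]; exists B => // z yz; apply: eB.
rewrite [e]splitr; apply: ball_triangle xy _.
exact: le_ball (ltW ke) _ yz.
Qed.

(** The closures [L i] and [T i] of the images of opposite faces are disjoint, which yields an open
    cover [O 0], ..., [O m] of [H]. Grid points are labelled through a refinement of order [n]. A
    cube carrying all labels gives [m.+1] members of the refinement with a common point, whence
    [m <= n]. *)
Lemma dimension_cube (H : topMetagroupType) (n : nat) (q : 'rV[R]_m -> H) :
  continuous q -> (forall x y, cube x -> cube y -> indist (q x) (q y) -> x = y) ->
  covering_dim_le H n -> (m <= n)%N.
Proof.
move=> qc qI Hn.
pose L i := closure (q @` lface i); pose T i := closure (q @` rface i).
have LT i z : L i z -> T i z -> False.
  move=> /(closure_compact_image qc (@face_compact i 0))[x [cx [j ji xj]] xz].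
  move=> /(closure_compact_image qc (@face_compact i 1))[y [cy [j' ji' yj]] yz].
  have xy := qI _ _ cx cy (indist_trans xz (indist_sym yz)).
  move: yj; rewrite -xy (_ : j' = j) ?xj; last by apply: val_inj; rewrite /= ji' ji.
  by move/eqP; rewrite eq_sym oner_eq0.
(* A point outside of all [O 0, ..., O j] lies in [L j], as [L i] does not meet
   [T i]; and [L m] is empty. *)
pose O j := ~` L j `&` (if j is j'.+1 then ~` T j' else setT).
have oO j : open (O j).
  apply: openI; first exact/closed_openC/closed_closure.
  by case: j => [|j]; [exact: openT|exact/closed_openC/closed_closure].
have Lm : L m = set0.
  rewrite /L (_ : lface m = set0) ?image_set0 ?closure0 //.
  by rewrite -subset0 => v [_ [j jm]]; have := ltn_ord j; rewrite jm ltnn.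
have coverO z : exists2 j, (j <= m)%N & O j z.
  apply: contrapT => nO.
  suff Lz j : (j <= m)%N -> L j z by have := Lz m (leqnn _); rewrite Lm.
  elim: j => [|j IH] jm; apply: contrapT => nL; apply: nO.
    by exists 0%N => //; split.
  by exists j.+1 => //; split=> // Tz; exact: LT (IH (ltnW jm)) Tz.
have [|||V [_ oV cV VU Vn]] := Hn [set O j | j in `I_m.+1].
- exact: finite_image (finite_II _).
- by move=> _ [j _ <-].
- apply/seteqP; split=> // z _; have [j jm Oz] := coverO z.
  by exists (O j) => //; exists j.
have /choice[lab labP] B : exists j, V B -> (j <= m)%N /\ B `<=` O j.
  have [VB|] := pselect (V B); last by exists 0%N.
  by have [_ [j jm <-] BO] := VU _ VB; exists j.
have [N _ /(_ N (leqnn N)) leb] := lebesgue_number qc oV cV.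
(* The mesh [1 / k] has to be strictly below the Lebesgue number [1 / N.+1]. *)
pose k := N.+2.
(* Truncation by [minn] keeps [pt v] in the cube for every sequence [v], so that labels are defined
   everywhere. *)
pose pt (v : seq nat) : 'rV[R]_m := \row_i ((minn (nth 0%N v i) k)%:R / k%:R).
have k0 : (0 : R) < k%:R by rewrite ltr0n.
have ptc v : cube (pt v).
  move=> i; rewrite mxE divr_ge0 //= ler_pdivrMr // mul1r ler_nat.
  exact: geq_minr.
have /choice[Bv BvP] v : exists B,
    V B /\ forall y, ball (pt v) N.+1%:R^-1 y -> B (q y).
  by have [B] := leb _ (ptc v); exists B.
have Oq v : O (lab (Bv v)) (q (pt v)).
  have [VB BvB] := BvP v; apply: (labP _ VB).2; apply: BvB; apply: ballxx.
  by rewrite invr_gt0.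
have [|v sv|v i sv im vi|v i sv im vi|c cP] :=
  @cubical_sperner k m (fun v => lab (Bv v)).
- by [].
- by have [VB _] := BvP v; have [] := labP _ VB.
(* A grid point on the left face [i] is mapped into [L i], which [O i] avoids; on the right face [i]
   it is mapped into [T i], which [O i.+1] avoids. *)
- apply/eqP => li; have [+ _] := Oq v; rewrite li; apply.
  apply: subset_closure; exists (pt v) => //; split=> //.
  by exists (Ordinal im) => //; rewrite mxE /= vi min0n mul0r.
- apply/eqP => li; have [_] := Oq v; rewrite li; apply.
  apply: subset_closure; exists (pt v) => //; split=> //.
  by exists (Ordinal im) => //; rewrite mxE /= vi minnn divff ?gt_eqF.
have /choice[v vP] j : exists v, (j <= m)%N -> [/\ size v = m, lab (Bv v) = j &
    forall i, (i < m)%N ->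
      (nth 0 c i <= nth 0 v i <= (nth 0 c i).+1)%N /\ (nth 0 v i <= k)%N].
  by have [jm|] := leqP j m; [have [v] := cP j jm; exists v|exists [::]].
(* The vertex labelled [0] is the common point: it lies within [1 / k] of the vertex with any other
   label, hence in the set attached to that vertex. *)
pose x := pt (v 0%N).
have sub : `I_m.+1 `<=` lab @` [set B | V B /\ B (q x)].
  move=> j; rewrite /= ltnS => jm; have [sj lj cj] := vP j jm.
  exists (Bv (v j)) => //; have [VB BvB] := BvP (v j); split=> //; apply: BvB.
  split; first by rewrite invr_gt0.
  move=> i i'; rewrite /ball /= !mxE -mulrBl normrM [`|_^-1|]gtr0_norm ?invr_gt0 //.
  have [s0 _ c0] := vP 0%N isT.
  have [/andP[cj1 cj2] jk] := cj _ (ltn_ord i').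
  have [/andP[c01 c02] zk] := c0 _ (ltn_ord i').
  have le1 (a b d : nat) : (d <= a <= d.+1)%N -> (d <= b <= d.+1)%N ->
      `|a%:R - b%:R : R| <= 1.
    move=> /andP[da ad] /andP[db bd]; rewrite ler_distl lerBlDr !natr1 !ler_nat.
    by rewrite (leq_trans bd) // (leq_trans ad).
  apply: (@le_lt_trans _ _ k%:R^-1); last by rewrite ltf_pV2 ?posrE // ltr_nat.
  rewrite ler_piMl ?invr_ge0 // !(minn_idPl _) //.
  by apply: (le1 _ _ (nth 0%N c i')); rewrite ?cj1 ?c01.
have : (`I_m.+1 #<= `I_n.+1)%card.
  apply: card_le_trans (subset_card_le sub) _.
  exact: card_le_trans (card_image_le _ _) (Vn _).
by rewrite card_le_II.
Qed.

End dimension.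

(** * Central extensions *)

Section central_extension.
Local Open Scope ring_scope.

(** A normalized continuous 2-cochain. Its coboundary becomes the associator of the extension
    [ext]. *)
Record factor_set (C Q : topologicalZmodType) := FactorSet {
  fs_fun :> Q * Q -> C;
  fs_continuous : continuous fs_fun;
  fs0x : forall x, fs_fun (0, x) = 0;
  fsx0 : forall x, fs_fun (x, 0) = 0 }.

(** The cochain is a phantom argument of the carrier, so that the multiplication can be inferred
    from the type. *)
Definition ext (C Q : topologicalZmodType) (f : factor_set C Q) : Type :=
  (C * Q)%type.

Variables (C Q : topologicalZmodType) (f : factor_set C Q).
Local Notation G := (ext f).

HB.instance Definition _ := Topological.copy G (C * Q)%type.

Implicit Types g h k : G.

Definition ext_mul g h : G := (g.1 + h.1 + f (g.2, h.2), g.2 + h.2).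
Definition ext_ldiv g k : G :=
  (k.1 - g.1 - f (g.2, k.2 - g.2), k.2 - g.2).
Definition ext_rdiv k h : G :=
  (k.1 - h.1 - f (k.2 - h.2, h.2), k.2 - h.2).

Let ext_mul1g : left_id ((0, 0) : G) ext_mul.
Proof. by move=> [a x]; rewrite /ext_mul /= fs0x !add0r addr0. Qed.

Let ext_mulg1 : right_id ((0, 0) : G) ext_mul.
Proof. by move=> [a x]; rewrite /ext_mul /= fsx0 !addr0. Qed.

HB.instance Definition _ := hasMul.Build G ext_mul.
HB.instance Definition _ := Magma_isUMagma.Build G ext_mul1g ext_mulg1.

Lemma ext_mulE (a b : C) (x y : Q) :
  (((a, x) : G) * ((b, y) : G))%g = (a + b + f (x, y), x + y) :> G.
Proof. by []. Qed.

Let ext_ldivP g k h : (g * h)%g = k <-> h = ext_ldiv g k.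
Proof.
case: g h k => [a x] [b y] [c z]; rewrite ext_mulE /ext_ldiv /=.
split=> [[<- <-]|[-> ->]].
  have -> : x + y - x = y by rewrite addrAC subrr add0r.
  by congr (_, _); rewrite addrAC addrK addrAC subrr add0r.
rewrite [x + _]addrC subrK; congr (_, _).
by rewrite [c - a - _]addrAC [a + _]addrC subrK subrK.
Qed.

Let ext_rdivP h k g : (g * h)%g = k <-> g = ext_rdiv k h.
Proof.
case: g h k => [a x] [b y] [c z]; rewrite ext_mulE /ext_rdiv /=.
split=> [[<- <-]|[-> ->]]; first by rewrite addrK [a + b + _]addrAC !addrK.
by rewrite subrK [c - b - _]addrAC !subrK.
Qed.

Lemma ext_center (t : C) : mcenter G ((t, 0) : G).
Proof.
split; [split; [split|]|] => [[b y]|[b y] [c z]|[b y] [c z]|[b y] [c z]];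
  rewrite !ext_mulE !(fs0x, fsx0, addr0, add0r) ?addrA //.
  by rewrite addrC.
by congr (_, _); rewrite /= [LHS]addrAC.
Qed.

Let ext_mulgA_center g h k :
  exists2 t, mcenter G t & ((g * h) * k = t * (g * (h * k)))%g.
Proof.
case: g h k => [a x] [b y] [c z].
(* The coboundary of [f], placed in the central factor. *)
exists (f (x, y) + f (x + y, z) - f (y, z) - f (x, y + z), 0).
  exact: ext_center.
rewrite !ext_mulE fs0x !(add0r, addr0); congr (_, _) => /=;
  last exact: esym (addrA _ _ _).
set u := f (x, y); set v := f (x + y, z); set w := f (y, z).
set s := f (x, y + z).
rewrite [a + _ + s]addrC [RHS]addrA subrK.
rewrite [a + (_ + w)]addrA [_ + _ + w]addrC [RHS]addrA subrK.
by rewrite [RHS]addrC !addrA; congr (_ + v); rewrite [LHS]addrAC.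
Qed.

HB.instance Definition _ := UMagma_isMetagroup.Build G
  ext_ldivP ext_rdivP ext_mulgA_center.

End central_extension.

Section central_extension_topology.
Variables (C Q : topologicalZmodType) (f : factor_set C Q).
Local Open Scope ring_scope.
Local Notation G := (ext f).

Lemma continuousD (T : topologicalType) (M : topologicalZmodType) (u v : T -> M) :
  continuous u -> continuous v -> continuous (fun t => u t + v t).
Proof. exact: (continuous_pair (@add_continuous M)). Qed.

Lemma continuousB (T : topologicalType) (M : topologicalZmodType) (u v : T -> M) :
  continuous u -> continuous v -> continuous (fun t => u t - v t).
Proof. exact: (continuous_pair (@sub_continuous M)). Qed.

Lemma continuous_ext (T : topologicalType) (u : T -> C) (v : T -> Q) :
  continuous u -> continuous v -> continuous (fun t => (u t, v t) : G).
Proof. by move=> uc vc t; apply: cvg_pair; [exact: uc|exact: vc]. Qed.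

Lemma ext_fst_continuous : continuous (fun g : G => g.1).
Proof. by move=> g; exact: cvg_fst. Qed.

Lemma ext_snd_continuous : continuous (fun g : G => g.2).
Proof. by move=> g; exact: cvg_snd. Qed.

Lemma continuous_comp_fst (A B D : topologicalType) (u : A -> D) :
  continuous u -> continuous (fun x : A * B => u x.1).
Proof. by move=> uc x; apply: continuous_comp; [exact: cvg_fst|exact: uc]. Qed.

Lemma continuous_comp_snd (A B D : topologicalType) (u : B -> D) :
  continuous u -> continuous (fun x : A * B => u x.2).
Proof. by move=> uc x; apply: continuous_comp; [exact: cvg_snd|exact: uc]. Qed.

Let fst1 := continuous_comp_fst (B := G) ext_fst_continuous.
Let fst2 := continuous_comp_fst (B := G) ext_snd_continuous.
Let snd1 := continuous_comp_snd (A := G) ext_fst_continuous.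
Let snd2 := continuous_comp_snd (A := G) ext_snd_continuous.

Let ext_mul_continuous : continuous (fun x : G * G => (x.1 * x.2)%g).
Proof.
apply: continuous_ext; last exact: continuousD.
apply: continuousD; first exact: continuousD.
exact: continuous_pair (@fs_continuous _ _ f) _ _.
Qed.

Let ext_ldiv_continuous : continuous (fun x : G * G => ldiv x.1 x.2).
Proof.
have d := continuousB snd2 fst2.
apply: continuous_ext => //.
apply: continuousB; first exact: continuousB.
exact: continuous_pair (@fs_continuous _ _ f) _ _.
Qed.

Let ext_rdiv_continuous : continuous (fun x : G * G => rdiv x.1 x.2).
Proof.
have d := continuousB fst2 snd2.
apply: continuous_ext => //.
apply: continuousB; first exact: continuousB.
exact: continuous_pair (@fs_continuous _ _ f) _ _.
Qed.

HB.instance Definition _ := Metagroup_isTopMetagroup.Build G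
  ext_mul_continuous ext_ldiv_continuous ext_rdiv_continuous.

End central_extension_topology.

(** A two-point indiscrete space is mapped to [x] and [y]. Continuity of this map can be checked on
    coordinates, where it follows from indistinguishability of the two values. *)
Lemma indist_coord (S : inverse_system) (x y : inverse_limit S) :
  (forall j, indist (Defs.coord x j) (Defs.coord y j)) -> indist x y.
Proof.
move=> xy; pose B := initial_topology (fun _ : bool => true).
pose h (b : B) : inverse_limit S := if b then x else y.
have hc : continuous h.
  apply: continuous_coord => j; apply/continuousP => U oU.
  have UE : U (Defs.coord x j) <-> U (Defs.coord y j).
    by split; [exact: xy|apply: (indist_sym (xy j))].
  have [Ux|Ux] := pselect (U (Defs.coord x j)).
    rewrite (_ : _ @^-1` U = setT); first exact: openT.
    by rewrite -subTset => -[_|_]; [exact: Ux|apply/UE].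
  rewrite (_ : _ @^-1` U = set0); first exact: open0.
  by rewrite -subset0 => -[|/UE].
have /(indist_continuous hc) : indist (true : B) (false : B).
  by move=> _ [V _ <-] Vt.
by [].
Qed.

(** * Obstruction to being a limit of finite-dimensional metagroups *)

Section obstruction.
Local Open Scope ring_scope.
Variables (C Q : topologicalZmodType) (f : factor_set C Q).
Local Notation G := (ext f).
(** The set [A] expresses that [C] has no small subgroups: it stays away from [0], but every nonzero
    element has a multiple in it. *)
Variable A : set C.
Hypotheses (C1 : @accessible_space C) (Acpt : compact A) (A0 : ~ A 0)
  (Asub : forall c : C, c <> 0 -> exists n, A (c *+ n)).

Let central (c : C) : G := (c, 0).

Let central_continuous : continuous central.
Proof. exact: continuous_ext (fun=> cvg_id) (fun=> cvg_cst _). Qed.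

Let centralD (c d : C) : central (c + d) = (central c * central d)%g.
Proof. by rewrite /central ext_mulE fs0x !addr0. Qed.

Let centralMn (H : topMetagroupType) (phi : G -> H) (c : C) n : mhom phi ->
  indist (phi (central c)) 1%g -> indist (phi (central (c *+ n))) 1%g.
Proof.
move=> phiM c1; elim: n => [|n IH]; first by rewrite mulr0n (mhom1 phiM).
rewrite mulrS centralD phiM.
apply: (indist_trans (indist_continuous (@mulr_continuous _ _) c1)).
by rewrite mul1g.
Qed.

(** The sets [K j] of central elements that become trivial in the [j]-th factor are closed and
    decreasing. If none were trivial, all would meet the compact set [A], hence have a common point
    in it. That point is trivial in the limit, so [psi] and the axiom T1 on [C] force it to be [0],
    which is not in [A]. *)
Lemma central_injective_factor (S : inverse_system) (phi : G -> inverse_limit S)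
    (psi : inverse_limit S -> G) :
  cancel phi psi -> cont_hom phi -> continuous psi ->
  exists j : sys_index S,
    forall c, indist (Defs.coord (phi (central c)) j) 1%g -> c = 0.
Proof.
move=> phiK [phiM phic] psic; apply: contrapT => /forallNP nj.
pose K j := [set c | indist (Defs.coord (phi (central c)) j) 1%g].
have KS i j : (i <= j)%O -> K j `<=` K i.
  move=> ij c /(indist_continuous (sys_map_hom ij).2).
  by rewrite coordP (mhom1 (sys_map_hom ij).1).
have K0 j : A `&` K j !=set0.
  have /existsNP[c] := nj j; move=> /not_implyP[c1 /Asub[n An]].
  exists (c *+ n); split => //.
  apply: (@centralMn _ (fun g => Defs.coord (phi g) j)) => // g h.
  by rewrite phiM.
have Kcl j : closed (K j).
  rewrite -[K j]setCK; apply: open_closedC; rewrite openE => c.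
  move=> /existsNP[U] /not_implyP[oU] /not_implyP[Uc nU1].
  pose W := (fun c => Defs.coord (phi (central c)) j) @^-1` U.
  apply: (@filterS _ _ _ W); first by move=> d Wd /(_ U oU Wd).
  apply: open_nbhs_nbhs; split => //; apply: open_comp => // d _.
  apply: (@continuous_comp _ _ _ (phi \o central) (fun x => Defs.coord x j));
    last exact: Defs.coord_continuous.
  by apply: continuous_comp; [exact: central_continuous|exact: phic].
pose F := filter_from [set: sys_index S] (fun j => A `&` K j).
have FF : ProperFilter F.
  apply: filter_from_proper => [|j _]; last exact: K0.
  apply: filter_from_filter; first by case: (sys_inhabited S) => j; exists j.
  move=> i j _ _; have [k [ik jk]] := sys_directed i j; exists k => //.
  by move=> c [Ac Kc]; split; split=> //; [exact: KS ik _ Kc|exact: KS jk _ Kc].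
have FA : F A by case: (sys_inhabited S) => j; exists j => // c [].
have [c [Ac Fc]] := Acpt FF FA.
have Kc j : K j c.
  apply: (Kcl j) => B nB; have [|d [[_ Kd] Bd]] := Fc (A `&` K j) B _ nB.
    by exists j.
  by exists d.
have /(indist_continuous psic) : indist (phi (central c)) 1%g.
  by apply: indist_coord => j; rewrite (coord_mkL (@threads_one S)); exact: Kc.
rewrite -(mhom1 phiM) !phiK => /(indist_continuous (@ext_fst_continuous _ _ f)) /= c0.
have [c0E|/eqP/C1[U [oU cU U0]]] := pselect (c = 0).
  by apply: A0; rewrite -c0E.
by move: U0 cU; rewrite !inE => nU0 /(c0 _ oU).
Qed.

(** For [h = (0, y)] the products [g * h] and [h * g] differ by the central element
    [f (x, y) - f (y, x)]. Both have images indistinguishable from [phi h], so this element lies in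
    the kernel and vanishes. *)
Lemma kernel_symmetric (H : topMetagroupType) (phi : G -> H) :
  mhom phi -> (forall c, indist (phi (central c)) 1%g -> c = 0) ->
  forall g : G, indist (phi g) 1%g -> forall y, f (g.2, y) = f (y, g.2).
Proof.
move=> phiM phi1 [a x] g1 y /=.
pose g : G := (a, x); pose h : G := (0, y).
have ghE : (central (f (x, y) - f (y, x)) * (h * g))%g = (g * h)%g.
  rewrite /central !ext_mulE fs0x !add0r !addr0 [y + x]addrC; congr (_, _).
  by rewrite [a + f (y, x)]addrC addrA subrK addrC.
apply/eqP; rewrite -subr_eq0; apply/eqP/phi1.
have -> : phi (central (f (x, y) - f (y, x))) = rdiv (phi (g * h)%g) (phi (h * g)%g).
  by apply/rdivP; rewrite -phiM ghE.
have gh_hg : indist (phi (g * h)%g) (phi (h * g)%g).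
  rewrite !phiM; apply: (@indist_trans _ _ (phi h)).
    by have := indist_continuous (@mulr_continuous _ (phi h)) g1; rewrite mul1g.
  have := indist_continuous (@mull_continuous _ (phi h)) (indist_sym g1).
  by rewrite mulg1.
have := indist_continuous (@rdivr_continuous _ (phi (h * g)%g)) gh_hg.
by rewrite [X in indist _ X](_ : _ = 1%g) //; apply/esym/rdivP; rewrite mul1g.
Qed.

(** If the chosen factor has dimension at most [n], the cube of dimension [n.+1] is mapped to it
    through [v |-> (0, q _ v)]. Points with indistinguishable images have a left quotient in the
    kernel; its [Q]-component is [q m y - q m x], so [kernel_symmetric] identifies them. *)
Lemma not_decomposed (R : realType) (q : forall m, 'rV[R]_m -> Q) :
  (forall m, continuous (q m)) ->
  (forall m (x y : 'rV[R]_m), cube x -> cube y ->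
     (forall z, f (q m y - q m x, z) = f (z, q m y - q m x)) -> x = y) ->
  ~ exists S : inverse_system,
      (forall j : sys_index S, finite_covering_dim (sys_obj j)) /\ decomposed G S.
Proof.
move=> qc qI [S [Sdim [phi [psi [phiK _ [phiM phic] [_ psic]]]]]].
have [j jI] := central_injective_factor phiK (conj phiM phic) psic.
have [n Hn] := Sdim j.
pose phj g := Defs.coord (phi g) j.
have phjM : mhom phj by move=> g h; rewrite /phj phiM.
suff : (n.+1 <= n)%N by rewrite ltnn.
apply: (@dimension_cube R n.+1 (sys_obj j) n (fun v => phj (0, q _ v))) => //.
  move=> v; apply: (@continuous_comp _ _ _ (fun v => phi (0, q _ v))
    (fun x => Defs.coord x j)); last exact: Defs.coord_continuous.
  apply: (@continuous_comp _ _ _ (fun v => (0, q _ v) : G) phi); last exact: phic.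
  apply: (@continuous_ext _ _ f _ (fun=> 0) (q n.+1)); last exact: qc.
  exact: cst_continuous.
move=> x y cx cy xy; apply: qI => //.
suff /(kernel_symmetric phjM jI) :
  indist (phj (ldiv ((0, q _ x) : G) ((0, q _ y) : G))) 1%g by [].
rewrite (mhom_ldiv phjM).
have := indist_continuous (@ldivl_continuous _ (phj (0, q _ x))) (indist_sym xy).
by rewrite ldivxx.
Qed.

End obstruction.

(** * Path connectedness *)

Lemma continuous_prod (I : Type) (T : topologicalType) (Y : I -> topologicalType)
    (f : T -> prod_topology Y) :
  (forall i, continuous (fun t => f t i)) -> continuous f.
Proof.
by move=> fc t; apply/cvg_sup => i; apply: (@continuous_comp_initial) t; exact: fc.
Qed.

Lemma prod_coord_continuous (I : eqType) (Y : I -> topologicalType) (i : I) :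
  continuous (fun f : prod_topology Y => f i).
Proof. exact: proj_continuous. Qed.

Lemma connected_discrete (T : topologicalType) (D : discreteTopologicalType)
    (d : T -> D) (A : set T) x y :
  continuous d -> connected A -> A x -> A y -> d x = d y.
Proof.
move=> dc cA Ax Ay; have : A `&` d @^-1` [set d x] = A.
  apply: cA; first by exists x.
    exists (d @^-1` [set d x]) => //.
    by apply: open_comp => [? _|]; [exact: dc|exact: discrete_open].
  exists (d @^-1` [set d x]) => //.
  by apply: preimage_closed => [? _|]; [exact: dc|exact: discrete_closed].
by move=> E; move: Ay; rewrite -E => -[_ /= ->].
Qed.

Lemma accessible_separating (T : topologicalType) :
  (forall x y : T, x <> y -> exists (Y : topologicalType) (u : T -> Y),
    [/\ @accessible_space Y, continuous u & u x <> u y]) -> @accessible_space T.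
Proof.
move=> sep x y /eqP/sep[Y [u [Y1 uc /eqP/Y1[U [oU Ux Uy]]]]].
exists (u @^-1` U); split; first by apply: open_comp => // ? _; exact: uc.
  by move: Ux; rewrite !inE.
by move: Uy; rewrite !inE.
Qed.

Section paths.
Variable R : realType.
Local Open Scope ring_scope.

(** Paths are continuous on the whole line and constrained to [A] only on the unit interval, which
    keeps subspace topologies out of the definition. *)
Definition path_connected (T : topologicalType) (A : set T) :=
  forall x y, A x -> A y -> exists g : R -> T,
    [/\ continuous g, g 0 = x, g 1 = y & forall t, 0 <= t <= 1 -> A (g t)].

Definition locally_path_connected (T : topologicalType) :=
  forall (x : T) U, nbhs x U -> exists V, [/\ nbhs x V, V `<=` U & path_connected V].

Lemma path_connected_connected (T : topologicalType) (A : set T) :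
  path_connected A -> connected A.
Proof.
move=> pA; have [->|/set0P[x Ax]] := eqVneq A set0; first exact: connected0.
rewrite -(@connected_component_id _ A x) //; first exact: component_connected.
have [g gP] : exists g : T -> R -> T, forall y, A y ->
    [/\ continuous (g y), g y 0 = x, g y 1 = y & forall t, 0 <= t <= 1 -> A (g y t)].
  have /choice[g gP] y : exists g : R -> T, A y ->
    [/\ continuous g, g 0 = x, g 1 = y & forall t, 0 <= t <= 1 -> A (g t)].
    have [Ay|] := pselect (A y); last by exists (fun=> x).
    by have [g] := pA _ _ Ax Ay; exists g.
  by exists g.
rewrite (_ : A = \bigcup_(y in A) (g y @` `[0, 1])).
  apply: bigcup_connected.
    exists x => y /gP[_ <- _ _].
    by exists 0; rewrite //= in_itv /= lexx ler01.
  move=> y /gP[gc _ _ _]; apply: connected_continuous_connected.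
    exact: segment_connected.
  exact: continuous_subspaceT.
apply/seteqP; split=> [y Ay|_ [y /gP[_ _ _ gA] [t + <-]]]; last first.
  by rewrite /= in_itv; exact: gA.
by exists y => //; exists 1; [rewrite /= in_itv /= ler01 lexx|have [] := gP _ Ay].
Qed.

(** Connected components of an open set [O] are open, as each of their points has a connected
    neighbourhood inside [O]. *)
Lemma locally_path_connectedW (T : topologicalType) :
  locally_path_connected T -> locally_connected T.
Proof.
move=> lT; split=> [V []//|x U]; rewrite nbhsE => -[O [oO Ox] OU].
exists (connected_component O x); last first.
  by apply: subset_trans OU; exact: connected_component_sub.
split; last exact: connected_component_refl.
split; last exact: component_connected.
rewrite openE => y xy; have Oy := connected_component_sub xy.
have [V [yV VO /path_connected_connected cV]] := lT _ _ (open_nbhs_nbhs (conj oO Oy)).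
apply: filterS (yV) => z Vz; apply: connected_component_trans xy _.
by exists V => //; split=> //; exact: nbhs_singleton.
Qed.

Lemma path_connected1 (T : topologicalType) (x : T) : path_connected [set x].
Proof.
by move=> _ _ -> ->; exists (fun=> x); split=> // t; exact: cvg_cst.
Qed.

Lemma path_connected_setX (S T : topologicalType) (A : set S) (B : set T) :
  path_connected A -> path_connected B -> path_connected (A `*` B).
Proof.
move=> pA pB [x y] [x' y'] [/= Ax By] [/= Ax' By'].
have [g [gc g0 g1 gA]] := pA _ _ Ax Ax'; have [h [hc h0 h1 hB]] := pB _ _ By By'.
exists (fun t => (g t, h t)); split; rewrite ?g0 ?h0 ?g1 ?h1 //.
  by move=> t; apply: cvg_pair; [exact: gc|exact: hc].
by move=> t t01; split=> /=; [exact: gA|exact: hB].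
Qed.

Lemma path_connected_prod (I : Type) (Y : I -> topologicalType)
    (A : forall i, set (Y i)) :
  (forall i, path_connected (A i)) ->
  path_connected [set x : prod_topology Y | forall i, A i (x i)].
Proof.
move=> pA x y Ax Ay.
have [g gP] : exists g : forall i, R -> Y i, forall i,
    [/\ continuous (g i), g i 0 = x i, g i 1 = y i &
      forall t, 0 <= t <= 1 -> A i (g i t)].
  exists (fun i => projT1 (cid (pA i _ _ (Ax i) (Ay i)))) => i.
  exact: (projT2 (cid (pA i _ _ (Ax i) (Ay i)))).
exists (fun t i => g i t); split.
- by apply: continuous_prod => i; have [] := gP i.
- by apply: functional_extensionality_dep => i; have [] := gP i.
- by apply: functional_extensionality_dep => i; have [] := gP i.
- by move=> t t01 i; have [_ _ _] := gP i; exact.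
Qed.

Lemma locally_path_connected_setX (S T : topologicalType) :
  locally_path_connected S -> locally_path_connected T ->
  locally_path_connected (S * T)%type.
Proof.
move=> lS lT [x y] U [[A B] /= [xA yB] ABU].
have [V [xV VA pV]] := lS _ _ xA; have [W [yW WB pW]] := lT _ _ yB.
exists (V `*` W); split; last exact: path_connected_setX.
  by exists (V, W).
by move=> [a b] [/= Va Wb]; apply: ABU; split; [exact: VA|exact: WB].
Qed.

Lemma nbhs_prod (Y : nat -> topologicalType) (x : prod_topology Y) U : nbhs x U ->
  exists K (A : forall i, set (Y i)), (forall i, nbhs (x i) (A i)) /\
    [set y | forall i, (i < K)%N -> A i (y i)] `<=` U.
Proof.
pose cyl (KA : nat * forall i, set (Y i)) : set (prod_topology Y) :=
  [set y | forall i, (i < KA.1)%N -> KA.2 i (y i)].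
pose D := [set KA : nat * forall i, set (Y i) | forall i, nbhs (x i) (KA.2 i)].
pose F := filter_from D cyl.
suff Fx : F --> x by move=> /Fx[[K A] DA AU]; exists K, A.
have FF : Filter F.
  apply: filter_from_filter; first by exists (0%N, fun=> setT) => i; exact: filterT.
  move=> [K A] [L B] DA DB; exists (maxn K L, fun i => A i `&` B i).
    by move=> i; apply: filterI; [exact: DA|exact: DB].
  by move=> y yP; split=> i iK; have [] := yP i _; rewrite //= leq_max iK ?orbT.
apply/cvg_sup => j V [_ [[B oB <-] /= Bxj BV]].
(* The cylinder that constrains coordinate [j] alone; [B] is transported along the equality
   [i = j]. *)
exists (j.+1, fun i => if pselect (i = j) is left e
  then eq_rect j (fun i => set (Y i)) B i (esym e) else setT).
  move=> i /=; case: pselect => [e|_]; last exact: filterT.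
  by case: _ / (esym e); exact: open_nbhs_nbhs.
move=> y /(_ j (ltnSn j)) /=; case: pselect => // e.
by rewrite (Prop_irrelevance (esym e) erefl) /= => By; exact: BV.
Qed.

(** A basic neighbourhood constrains finitely many coordinates; the other factors are kept whole,
    and they are path connected. *)
Lemma locally_path_connected_prod (Y : nat -> topologicalType) :
  (forall i, path_connected [set: Y i]) -> (forall i, locally_path_connected (Y i)) ->
  locally_path_connected (prod_topology Y).
Proof.
move=> pY lY x U /nbhs_prod[K [A [xA AU]]].
have [V VP] : exists V : forall i, set (Y i), forall i,
    [/\ nbhs (x i) (V i), V i `<=` A i & path_connected (V i)].
  exists (fun i => projT1 (cid (lY i _ _ (xA i)))) => i.
  exact: (projT2 (cid (lY i _ _ (xA i)))).
pose W i := if (i < K)%N then V i else setT.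
exists [set y | forall i, W i (y i)]; split; last first.
- by apply: path_connected_prod => i; rewrite /W; case: ifP => // _; have [] := VP i.
- move=> y Wy; apply: AU => i iK; have [_ VA _] := VP i; apply: VA.
  by have := Wy i; rewrite /W iK.
have : nbhs x [set y : prod_topology Y | forall i : 'I_K, V i (y i)].
  apply: (@filter_forall _ _ (fun i : 'I_K => [set y : prod_topology Y | V i (y i)])
    (nbhs x) (nbhs_filter x)) => i.
  apply: (@prod_coord_continuous _ Y i x).
  by have [] := VP i.
apply: filterS => y Vy i; rewrite /W; case: ifP => // iK.
exact: (Vy (Ordinal iK)).
Qed.

End paths.

(** * The circle *)

Definition unit_circle (R : realType) : set (R * R) :=
  [set p | p.1 ^+ 2 + p.2 ^+ 2 = 1]%R.

Definition circle (R : realType) : Type := set_type (@unit_circle R).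

HB.instance Definition _ (R : realType) :=
  Topological.copy (circle R) (set_type (@unit_circle R)).

Section circle.
Variable R : realType.
Local Open Scope ring_scope.
Implicit Types z w : circle R.

Definition re z : R := (set_val z).1.
Definition im z : R := (set_val z).2.

Lemma re_im z : re z ^+ 2 + im z ^+ 2 = 1.
Proof. exact: (set_valP z). Qed.

Lemma circle_eq z w : re z = re w -> im z = im w -> z = w.
Proof.
move=> zw1 zw2; apply: eq_sig_hprop => [? ? ?|]; first exact: bool_irrelevance.
move: zw1 zw2; rewrite /re /im !set_valE => zw1 zw2.
by rewrite [LHS]surjective_pairing [RHS]surjective_pairing; congr (_, _).
Qed.

Definition mk_circle (a b : R) (ab : a ^+ 2 + b ^+ 2 = 1) : circle R :=
  exist _ (a, b) (mem_set (ab : unit_circle (a, b))).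

Lemma re_mk a b (ab : a ^+ 2 + b ^+ 2 = 1) : re (mk_circle ab) = a.
Proof. by rewrite /re set_valE. Qed.

Lemma im_mk a b (ab : a ^+ 2 + b ^+ 2 = 1) : im (mk_circle ab) = b.
Proof. by rewrite /im set_valE. Qed.

Fact circle_add_subproof z w :
  (re z * re w - im z * im w) ^+ 2 + (re z * im w + im z * re w) ^+ 2 = 1.
Proof.
by rewrite -[RHS]mulr1 -{1}(re_im z) -(re_im w); ring.
Qed.

Fact circle_zero_subproof : 1 ^+ 2 + 0 ^+ 2 = 1 :> R.
Proof. by ring. Qed.

Fact circle_opp_subproof z : re z ^+ 2 + (- im z) ^+ 2 = 1.
Proof. by rewrite sqrrN re_im. Qed.

(** Multiplication of complex numbers of modulus one, written additively. *)
Definition circle_add z w := mk_circle (circle_add_subproof z w).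
Definition circle_zero := mk_circle circle_zero_subproof.
Definition circle_opp z := mk_circle (circle_opp_subproof z).

Let circle_addA : associative circle_add.
Proof. by move=> u z w; apply: circle_eq; rewrite !(re_mk, im_mk); ring. Qed.

Let circle_addC : commutative circle_add.
Proof. by move=> z w; apply: circle_eq; rewrite !(re_mk, im_mk); ring. Qed.

Let circle_add0 : left_id circle_zero circle_add.
Proof. by move=> z; apply: circle_eq; rewrite !(re_mk, im_mk); ring. Qed.

Let circle_addN : left_inverse circle_zero circle_opp circle_add.
Proof.
move=> z; apply: circle_eq; rewrite !(re_mk, im_mk); last by ring.
by rewrite -(re_im z); ring.
Qed.

HB.instance Definition _ := GRing.isZmodule.Build (circle R)
  circle_addA circle_addC circle_add0 circle_addN.

Lemma reD z w : re (z + w) = re z * re w - im z * im w. Proof. exact: re_mk. Qed.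
Lemma imD z w : im (z + w) = re z * im w + im z * re w. Proof. exact: im_mk. Qed.
Lemma reN z : re (- z) = re z. Proof. exact: re_mk. Qed.
Lemma imN z : im (- z) = - im z. Proof. exact: im_mk. Qed.
Lemma re0 : re 0 = 1. Proof. exact: re_mk. Qed.
Lemma im0 : im 0 = 0. Proof. exact: im_mk. Qed.

Lemma re_continuous : continuous re.
Proof.
move=> z; apply: (@continuous_comp _ _ _ set_val fst).
  exact: initial_continuous.
exact: cvg_fst.
Qed.

Lemma im_continuous : continuous im.
Proof.
move=> z; apply: (@continuous_comp _ _ _ set_val snd).
  exact: initial_continuous.
exact: cvg_snd.
Qed.

Lemma continuous_circle (T : topologicalType) (f : T -> circle R) :
  continuous (re \o f) -> continuous (im \o f) -> continuous f.
Proof.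
move=> rc ic; apply: continuous_comp_initial.
have -> : set_val \o f = fun t => (re (f t), im (f t)).
  by apply/funext => u /=; rewrite /re /im; case: (set_val _).
exact: (@continuous_pair _ _ _ _ id _ _ (fun=> cvg_id) rc ic).
Qed.

Let circle_sub_continuous : continuous (fun x : circle R * circle R => x.1 - x.2).
Proof.
have r1 := continuous_comp_fst (B := circle R) re_continuous.
have r2 := continuous_comp_snd (A := circle R) re_continuous.
have i1 := continuous_comp_fst (B := circle R) im_continuous.
have i2 := continuous_comp_snd (A := circle R) im_continuous.
apply: continuous_circle => x.
  rewrite (_ : _ \o _ = fun x => re x.1 * re x.2 + im x.1 * im x.2); last first.
    by apply/funext => y /=; rewrite reD reN imN; ring.
  by apply: cvgD; apply: cvgM; [exact: r1|exact: r2|exact: i1|exact: i2].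
rewrite (_ : _ \o _ = fun x => im x.1 * re x.2 - re x.1 * im x.2); last first.
  by apply/funext => y /=; rewrite imD reN imN; ring.
by apply: cvgB; apply: cvgM; [exact: i1|exact: r2|exact: r1|exact: i2].
Qed.

HB.instance Definition _ :=
  PreTopologicalNmodule_isTopologicalZmodule.Build (circle R) circle_sub_continuous.

Lemma re_bound z : -1 <= re z <= 1.
Proof. by have := re_im z; have := sqr_ge0 (im z); nra. Qed.

Lemma re1_eq0 z : re z = 1 -> z = 0.
Proof.
move=> z1; apply: circle_eq; rewrite ?re0 ?im0 //.
by have := re_im z; rewrite z1 => h; apply/eqP; rewrite -sqrf_eq0; apply/eqP; lra.
Qed.

Lemma sqr1D_neq0 (t : R) : 1 + t ^+ 2 != 0.
Proof. by apply: lt0r_neq0; rewrite ltr_pwDl ?sqr_ge0. Qed.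

(* Rational parametrization of the circle minus [-1], by stereographic
   projection from [-1]. *)
Fact arc_subproof (t : R) :
  ((1 - t ^+ 2) / (1 + t ^+ 2)) ^+ 2 + (2 * t / (1 + t ^+ 2)) ^+ 2 = 1.
Proof.
have t1 := sqr1D_neq0 t.
by field.
Qed.

Definition arc (t : R) : circle R := mk_circle (arc_subproof t).

Lemma re_arc t : re (arc t) = (1 - t ^+ 2) / (1 + t ^+ 2). Proof. exact: re_mk. Qed.
Lemma im_arc t : im (arc t) = 2 * t / (1 + t ^+ 2). Proof. exact: im_mk. Qed.

Lemma arc0 : arc 0 = 0.
Proof.
by apply: re1_eq0; rewrite re_arc expr0n /= subr0 addr0 divr1.
Qed.

Lemma arcK : cancel arc (fun z => im z / (1 + re z)).
Proof.
move=> t; have t1 := sqr1D_neq0 t.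
rewrite re_arc im_arc.
have -> : 1 + (1 - t ^+ 2) / (1 + t ^+ 2) = 2 / (1 + t ^+ 2) by field.
by field.
Qed.

Lemma arc_inj : injective arc. Proof. exact: can_inj arcK. Qed.

Lemma im_arcK z : re z != -1 -> arc (im z / (1 + re z)) = z.
Proof.
move=> z1; have z0 : 1 + re z != 0 by rewrite addrC addr_eq0.
have := re_im z => zE.
have E : 1 + (im z / (1 + re z)) ^+ 2 = 2 / (1 + re z).
  have -> : (im z / (1 + re z)) ^+ 2 = (1 - re z ^+ 2) / (1 + re z) ^+ 2.
    by rewrite expr_div_n; congr (_ / _); rewrite -[in RHS]zE; ring.
  by field.
apply: circle_eq; rewrite ?re_arc ?im_arc E.
  have -> : (im z / (1 + re z)) ^+ 2 = 2 / (1 + re z) - 1 by rewrite -E; ring.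
  by field.
by field.
Qed.

Lemma arc_continuous : continuous arc.
Proof.
have c2 (t : R) : (fun t : R => t ^+ 2) @ t --> t ^+ 2.
  by apply: (cvgM (f := id) (g := id)); exact: cvg_id.
have ci (t : R) : (fun t : R => (1 + t ^+ 2)^-1) @ t --> (1 + t ^+ 2)^-1.
  by apply: cvgV; [exact: sqr1D_neq0|apply: cvgD; [exact: cvg_cst|exact: c2]].
apply: continuous_circle => t.
  rewrite (_ : _ \o _ = fun t => (1 - t ^+ 2) / (1 + t ^+ 2)); last first.
    by apply/funext => y /=; rewrite re_arc.
  by apply: cvgM; [apply: cvgB; [exact: cvg_cst|exact: c2]|exact: ci].
rewrite (_ : _ \o _ = fun t => 2 * t / (1 + t ^+ 2)); last first.
  by apply/funext => y /=; rewrite im_arc.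
by apply: cvgM; [apply: cvgM; [exact: cvg_cst|exact: cvg_id]|exact: ci].
Qed.

Lemma circle_accessible : @accessible_space (circle R).
Proof.
apply: accessible_separating => z w zw.
have R1 : @accessible_space R by apply: hausdorff_accessible; exact: Rhausdorff.
have [e|e] := pselect (re z = re w); last first.
  by exists R, re; split=> //; exact: re_continuous.
exists R, im; split=> //; first exact: im_continuous.
by move=> e'; apply: zw; exact: circle_eq.
Qed.

Fact antipode_subproof : (-1) ^+ 2 + 0 ^+ 2 = 1 :> R. Proof. by ring. Qed.

Definition antipode := mk_circle antipode_subproof.

Lemma re_antipode : re antipode = -1. Proof. exact: re_mk. Qed.
Lemma im_antipode : im antipode = 0. Proof. exact: im_mk. Qed.

Lemma half_circle z : 0 <= re z -> (arc @` `[-1, 1]) z.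
Proof.
move=> z0; exists (im z / (1 + re z)); last by apply: im_arcK; apply/eqP; lra.
have p : 0 < 1 + re z by lra.
have := re_im z => zE; have := re_bound z => zb.
by rewrite /= in_itv /= ler_pdivlMr // ler_pdivrMr //; nra.
Qed.

(** The closed right half and its translate by [antipode] cover the circle, and both are continuous
    images of a segment. *)
Lemma circle_compact : compact [set: circle R].
Proof.
rewrite (_ : setT = arc @` `[-1, 1] `|` (fun t => antipode + arc t) @` `[-1, 1]).
  apply: compactU; apply: continuous_compact; try exact: segment_compact;
  apply: continuous_subspaceT; first exact: arc_continuous.
  apply: continuousD; [exact: cst_continuous|exact: arc_continuous].
apply/esym; rewrite -subTset => z _; have [z0|z0] := leP 0 (re z).
  by left; exact: half_circle.
right; have [|t t1 tE] := @half_circle (z - antipode).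
  by rewrite reD reN imN re_antipode im_antipode; lra.
by exists t => //; rewrite tE addrC subrK.
Qed.

(** Applied to the stereographic coordinate [im / (1 + re)], whose denominator vanishes at the
    antipode. *)
Lemma near_quotient (T : topologicalType) (u v : T -> R) (x : T) (e : R) :
  continuous u -> continuous v -> u x = 0 -> 0 < v x -> 0 < e ->
  nbhs x [set y | 0 < v y /\ ball 0 e (u y / v y)].
Proof.
move=> uc vc ux vx e0.
have qx : (fun y => u y / v y) @ x --> (0 : R).
  rewrite -[X in _ --> X](mul0r (v x)^-1) -ux.
  by apply: cvgM; [exact: uc|apply: cvgV; [exact: lt0r_neq0|exact: vc]].
have A1 : \forall y \near x, ball 0 e (u y / v y) by apply: qx; exact: nbhsx_ballx.
have A2 : \forall y \near x, 0 < v y by exact: (cvgr_gt (v x) (vc x)).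

exact: filterS2 A2 A1.
Qed.

Lemma translate_path_connected z (A : set (circle R)) :
  path_connected R A -> path_connected R ((fun w => z + w) @` A).
Proof.
move=> pA _ _ [x Ax <-] [y Ay <-]; have [g [gc g0 g1 gA]] := pA _ _ Ax Ay.
exists (fun t => z + g t); split; rewrite ?g0 ?g1 //.
  by apply: continuousD => //; exact: cst_continuous.
by move=> t t1; exists (g t) => //; exact: gA.
Qed.

Lemma circle_path_connected : path_connected R [set: circle R].
Proof.
move=> x y _ _.
suff H (w : circle R) : exists g : R -> circle R,
    [/\ continuous g, g 0 = 0 & g 1 = w].
  have [g [gc g0 g1]] := H (y - x); exists (fun t => x + g t); split=> //.
  - by apply: continuousD => //; exact: cst_continuous.
  - by rewrite g0 addr0.
  - by rewrite g1 addrC subrK.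
have Hw (v : circle R) : re v != -1 ->
    exists g : R -> circle R, [/\ continuous g, g 0 = 0 & g 1 = v].
  move=> v1; pose s := im v / (1 + re v); exists (fun t => arc (t * s)).
  rewrite mul0r arc0 mul1r im_arcK //; split=> // t.
  apply: (@continuous_comp _ _ _ (fun t : R => t * s) arc); last exact: arc_continuous.
  by apply: cvgM; [exact: cvg_id|exact: cvg_cst].
have [w1|] := eqVneq (re w) (-1); last exact: Hw.
(* The antipode is twice the quarter turn [arc 1], so doubling a path to [arc 1] reaches it. *)
have [|g [gc g0 g1]] := Hw (arc 1).
  by rewrite re_arc expr1n subrr mul0r eq_sym oppr_eq0 oner_eq0.
exists (fun t => g t + g t); rewrite g0 g1 addr0; split=> //; first exact: continuousD.
have a1 : re (arc 1) = 0 by rewrite re_arc expr1n subrr mul0r.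
have b1 : im (arc 1) = 1 by rewrite im_arc expr1n; field.
apply: circle_eq; rewrite ?reD ?imD a1 b1 ?w1; first by ring.
have := re_im w; rewrite w1 => h.
by rewrite mul0r mulr0 addr0; apply/esym/eqP; rewrite -sqrf_eq0; apply/eqP; lra.
Qed.

Lemma circle_locally_path_connected : locally_path_connected R (circle R).
Proof.
move=> z U zU.
have tc : continuous (fun t => z + arc t).
  by apply: continuousD; [exact: cst_continuous|exact: arc_continuous].
have /nbhs_ballP[e e0 eU] : nbhs (0 : R) ((fun t => z + arc t) @^-1` U).
  by apply: tc; rewrite arc0 addr0.
exists ((fun w => z + w) @` (arc @` ball 0 e)); split.
- pose s w := im (w - z) / (1 + re (w - z)).
  have dc : continuous (fun w => w - z)
    by exact: continuousB (fun=> cvg_id) (@cst_continuous _ _ z).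
  have rc : continuous (fun w => re (w - z)).
    move=> w; apply: (@continuous_comp _ _ _ (fun w => w - z) re); first exact: dc.
    exact: re_continuous.
  have ic : continuous (fun w => im (w - z)).
    move=> w; apply: (@continuous_comp _ _ _ (fun w => w - z) im); first exact: dc.
    exact: im_continuous.
  have vc : continuous (fun w => 1 + re (w - z)).
    move=> w; apply: (@continuous_comp _ _ _ (fun w => re (w - z)) (+%R 1)).
      exact: rc.
    by apply: cvgD; [exact: cvg_cst|exact: cvg_id].
  have := @near_quotient _ _ _ z e ic vc; rewrite subrr re0 im0.
  move=> /(_ erefl (addr_gt0 ltr01 ltr01) e0).
  apply: filterS => w [v0 sw]; exists (w - z); last by rewrite addrC subrK.
  exists (s w) => //; apply: im_arcK; apply/eqP; lra.
- by move=> _ [_ [t te <-] <-]; exact: eU.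
- apply: translate_path_connected => _ _ [a ae <-] [b be <-].
  exists (fun t => arc (a + t * (b - a))); split.
  + move=> t; apply: (@continuous_comp _ _ _ (fun t : R => a + t * (b - a)) arc);
      last exact: arc_continuous.
    apply: cvgD; first exact: cvg_cst.
    by apply: cvgM; [exact: cvg_id|exact: cvg_cst].
  + by rewrite mul0r addr0.
  + by rewrite mul1r addrC subrK.
  + move=> t t01; exists (a + t * (b - a)) => //.
    move: ae be t01; rewrite /ball /= !sub0r !normrN !ltr_norml.
    move=> /andP[? ?] /andP[? ?] /andP[? ?].
    by case: (leP a b) => ?; apply/andP; split; nra.
Qed.

(** With [x = re w], doubling [w] turns [1 - x] into [2 (1 - x) (1 + x)], which is at least
    [2 (1 - x)] when [x >= 0]. If all multiples of [z] had positive real part, [1 - re] would grow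
    geometrically along [z *+ 2 ^ k] while staying below [1]. *)
Lemma circle_no_small_subgroup z : z <> 0 -> exists n, re (z *+ n) <= 0.
Proof.
move=> z0; apply: contrapT => /forallNP nz.
have pos n : 0 < re (z *+ n) by rewrite ltNge; apply/negP.
have u0 : 0 < 1 - re z.
  rewrite subr_gt0 lt_neqAle; have /andP[_ ->] := re_bound z.
  by rewrite andbT; apply/eqP => /re1_eq0.
have grow k : (1 - re z) * 2 ^+ k <= 1 - re (z *+ 2 ^ k).
  elim: k => [|k IH]; first by rewrite mulr1.
  rewrite expnS mul2n -addnn mulrnDr reD.
  have := pos (2 ^ k)%N; have := re_im (z *+ 2 ^ k).
  have /andP[_] := re_bound (z *+ 2 ^ k).
  move: IH; move: (re (z *+ _)) (im _) => x y; rewrite [2 ^+ k.+1]exprS.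
  move: (2 ^+ k) => p IH x1 xy x0.
  have ? : 0 <= (1 - x) * x by rewrite mulr_ge0 ?subr_ge0 // ltW.
  lra.
have lin k : (k%:R : R) <= 2 ^+ k by rewrite -natrX ler_nat ltnW // ltn_expl.
have := archi_boundP (ltW (divr_gt0 ltr01 u0)); set k := Num.bound _ => kb.
have := grow k; have := pos (2 ^ k)%N; have := lin k.
move: kb; rewrite ltr_pdivrMr // => kb lk pk gk.
have : (1 - re z) * k%:R <= (1 - re z) * 2 ^+ k by rewrite ler_pM2l.
lra.
Qed.

End circle.

(** * The metagroups of the family *)

Section zmod_instances.
Local Open Scope ring_scope.

Let prod_sub_continuous (M N : topologicalZmodType) :
  continuous (fun x : (M * N) * (M * N) => x.1 - x.2).
Proof.
have f1 : continuous (fun x : (M * N) * (M * N) => x.1.1).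
  by apply: continuous_comp_fst => x; exact: cvg_fst.
have s1 : continuous (fun x : (M * N) * (M * N) => x.1.2).
  by apply: continuous_comp_fst => x; exact: cvg_snd.
have f2 : continuous (fun x : (M * N) * (M * N) => x.2.1).
  by apply: continuous_comp_snd => x; exact: cvg_fst.
have s2 : continuous (fun x : (M * N) * (M * N) => x.2.2).
  by apply: continuous_comp_snd => x; exact: cvg_snd.
exact: (@continuous_pair _ _ _ _ id _ _ (fun=> cvg_id)
  (continuousB f1 f2) (continuousB s1 s2)).
Qed.

(* The library's instance on [M * N] is only available for modules over a
   common ring, and it hides any weaker instance on the same type. *)
Definition zprod (M N : topologicalZmodType) : Type := (M * N)%type.

HB.instance Definition _ (M N : topologicalZmodType) :=
  Topological.copy (zprod M N) (M * N)%type.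
HB.instance Definition _ (M N : topologicalZmodType) :=
  GRing.Zmodule.copy (zprod M N) (M * N)%type.
HB.instance Definition _ (M N : topologicalZmodType) :=
  PreTopologicalNmodule_isTopologicalZmodule.Build (zprod M N)
    (@prod_sub_continuous M N).

HB.instance Definition _ (I : Type) (M : zmodType) :=
  GRing.Zmodule.copy (prod_topology (fun _ : I => M)) (I -> M).

Let power_sub_continuous (I : eqType) (M : topologicalZmodType) :
  continuous (fun x : prod_topology (fun _ : I => M) *
                      prod_topology (fun _ : I => M) => x.1 - x.2).
Proof.
apply: continuous_prod => i.
have c := @prod_coord_continuous I (fun=> M) i.
exact: continuousB (continuous_comp_fst c) (continuous_comp_snd c).
Qed.

HB.instance Definition _ (I : eqType) (M : topologicalZmodType) :=
  PreTopologicalNmodule_isTopologicalZmodule.Build (prod_topology (fun _ : I => M))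
    (@power_sub_continuous I M).

HB.instance Definition _ (M : zmodType) :=
  GRing.Zmodule.copy (discrete_topology M) M.

Let discrete_sub_continuous (M : zmodType) :
  continuous (fun x : discrete_topology M * discrete_topology M => x.1 - x.2).
Proof.
move=> [x y] U /nbhs_singleton Uxy; exists ([set x], [set y]).
  by split; exact: discrete_set1.
by move=> [a b] [/= -> ->].
Qed.

HB.instance Definition _ (M : zmodType) :=
  PreTopologicalNmodule_isTopologicalZmodule.Build (discrete_topology M)
    (@discrete_sub_continuous M).

End zmod_instances.

(** * Continuity of suprema of functions with decaying bounds *)

Section weighted_sup.
Variable R : realType.
Local Open Scope ring_scope.

Lemma has_sup_range (u : nat -> R) : (forall k, u k <= 2 / k.+1%:R) ->
  has_sup (range u).
Proof.
move=> u2; split; first by exists (u 0%N); exists 0%N.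
exists 2 => _ [k _ <-]; apply: le_trans (u2 k) _.
by rewrite ler_pdivrMr // ler_peMr // ler1n.
Qed.

Lemma sup_le_add (u v : nat -> R) e : (forall k, v k <= 2 / k.+1%:R) ->
  (forall k, u k <= v k + e) -> sup (range u) <= sup (range v) + e.
Proof.
move=> v2 uv; apply: ge_sup; first by exists (u 0%N); exists 0%N.
move=> _ [k _ <-]; apply: le_trans (uv k) _; rewrite lerD2r.
by apply: sup_upper_bound; [exact: has_sup_range|exists k].
Qed.

(** Beyond a suitable [K] each [u k] varies by at most [e] because of its bound, so only finitely
    many continuity conditions remain. *)
Lemma continuous_sup (T : topologicalType) (u : nat -> T -> R) :
  (forall k, continuous (u k)) -> (forall k x, 0 <= u k x <= 2 / k.+1%:R) ->
  continuous (fun x => sup (range (fun k => u k x))).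
Proof.
move=> uc ub x; apply/cvgrPdist_le => e e0.
have [K _ /(_ K (leqnn K)) Ke] :=
  near_infty_natSinv_lt (PosNum (divr_gt0 e0 (ltr0n R 2))).
have near_x : nbhs x [set y | forall k : 'I_K, `|u k x - u k y| <= e].
  apply: (@filter_forall _ _ (fun k : 'I_K => [set y | `|u k x - u k y| <= e])
    (nbhs x) (nbhs_filter x)) => k.
  by have /cvgrPdist_le := uc k x; apply.
apply: filterS near_x => y xy.
have {}xy k : u k x <= u k y + e /\ u k y <= u k x + e.
  have [kK|Kk] := ltnP k K.
    by have := xy (Ordinal kK); rewrite ler_norml /= => /andP[? ?]; split; lra.
  have : k.+1%:R^-1 <= K.+1%:R^-1 :> R by rewrite lef_pV2 ?posrE // ler_nat.
  move: Ke (ub k x) (ub k y) => /=; move: (k.+1%:R^-1) (K.+1%:R^-1) => a b.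
  by move=> ? /andP[? ?] /andP[? ?] ?; split; lra.
have ub' z k : u k z <= 2 / k.+1%:R by have /andP[] := ub k z.
have := sup_le_add (ub' y) (fun k => (xy k).1).
have := sup_le_add (ub' x) (fun k => (xy k).2).
by rewrite ler_norml => ? ?; apply/andP; split; lra.
Qed.

End weighted_sup.

(** * The infinite torus, its twisting cochain and the resulting metagroups *)

Section torus.
Variable R : realType.
Local Open Scope ring_scope.

Definition torus : Type := prod_topology (fun _ : nat => circle R).
HB.instance Definition _ :=
  TopologicalZmodule.copy torus (prod_topology (fun _ : nat => circle R)).
Implicit Types x y : torus.

(** It vanishes exactly when the [k]-th coordinate is [0]. The weight makes the supremum over [k]
    continuous for the product topology. *)
Definition height (k : nat) x : R := (1 - re (x k)) / k.+1%:R.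

Lemma height_ge0 k x : 0 <= height k x.
Proof. by rewrite divr_ge0 // subr_ge0; have /andP[] := re_bound (x k). Qed.

Lemma height_le k x : height k x <= 2 / k.+1%:R.
Proof. by rewrite ler_pM2r ?invr_gt0 //; have /andP[] := re_bound (x k); lra. Qed.

Lemma torus_coord_continuous k : continuous (fun x => x k).
Proof. exact: (@prod_coord_continuous nat (fun=> circle R) k). Qed.

Lemma height_continuous k : continuous (height k).
Proof.
move=> x; apply: (@continuous_comp _ _ _ (fun x : torus => x k)
  (fun z => (1 - re z) / k.+1%:R)); first exact: torus_coord_continuous.
apply: (@continuous_comp _ _ _ (@re R) (fun a => (1 - a) / k.+1%:R)).
  exact: re_continuous.
by apply: cvgM; [apply: cvgB; [exact: cvg_cst|exact: cvg_id]|exact: cvg_cst].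
Qed.

Definition max_height x : R := sup (range (fun k => height k x)).

Lemma has_sup_height x : has_sup (range (fun k => height k x)).
Proof. by apply: has_sup_range => k; rewrite height_le. Qed.

Lemma le_max_height k x : height k x <= max_height x.
Proof. by apply: sup_upper_bound; [exact: has_sup_height|exists k]. Qed.

Lemma max_height_continuous : continuous max_height.
Proof.
apply: continuous_sup => [|k x]; first exact: height_continuous.
by rewrite height_ge0 height_le.
Qed.

Lemma height0 k : height k 0 = 0.
Proof. by rewrite /height re0 subrr mul0r. Qed.

Lemma max_height0 : max_height 0 = 0.
Proof.
apply/eqP; rewrite eq_le -{2}(height0 0) le_max_height andbT.
apply: ge_sup; first by exists (height 0 0); exists 0%N.
by move=> _ [k _ <-]; rewrite height0.
Qed.

Lemma max_height_eq0 x : max_height x = 0 -> x = 0.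
Proof.
move=> x0; apply: functional_extensionality_dep => k; apply: re1_eq0.
have := le_max_height k x; rewrite x0 ler_pdivrMr // mul0r.
by have := re_bound (x k); lra.
Qed.

(** The first argument enters through all torus coordinates, the second only through coordinate [0];
    this is the source of asymmetry. Injectivity of [arc] turns equal values into equal products of
    heights. *)
Definition twist_fun (D : topologicalZmodType)
    (p : zprod torus D * zprod torus D) : circle R :=
  arc (max_height p.1.1 * height 0 p.2.1).

Fact twist_continuous D : continuous (@twist_fun D).
Proof.
move=> p; apply: (@continuous_comp _ _ _
  (fun p : zprod torus D * zprod torus D => max_height p.1.1 * height 0 p.2.1)
  (@arc R)); last exact: arc_continuous.
have c1 : continuous (fun p : zprod torus D => max_height p.1).
  exact: continuous_comp_fst max_height_continuous.
have c2 : continuous (fun p : zprod torus D => height 0 p.1).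
  exact: continuous_comp_fst (@height_continuous 0).
have {}c1 := continuous_comp_fst (B := (zprod torus D)) c1.
have {}c2 := continuous_comp_snd (A := (zprod torus D)) c2.
by apply: cvgM; [exact: c1|exact: c2].
Qed.

Fact twist0x (D : topologicalZmodType) (x : zprod torus D) : @twist_fun D (0, x) = 0.
Proof. by rewrite /twist_fun /= max_height0 mul0r arc0. Qed.

Fact twistx0 (D : topologicalZmodType) (x : zprod torus D) : @twist_fun D (x, 0) = 0.
Proof. by rewrite /twist_fun /= height0 mulr0 arc0. Qed.

Definition twist (D : topologicalZmodType) :=
  @FactorSet (circle R) (zprod torus D) (@twist_fun D)
    (@twist_continuous D) (@twist0x D) (@twistx0 D).

Lemma twist_symmetric (D : topologicalZmodType) (w : zprod torus D) :
  (forall z, twist D (w, z) = twist D (z, w)) -> w.1 = 0.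
Proof.
move=> wz; pose y1 : torus := fun k => if k == 0%N then antipode R else 0.
pose y2 : torus := fun k => if k == 0%N then 0 else antipode R.
have H y : max_height w.1 * height 0 y = max_height y * height 0 w.1.
  exact/arc_inj/(wz (y, 0)).
have w0 : height 0 w.1 = 0.
  have := H y2; rewrite {1}/height /= re0 subrr mul0r mulr0 => /esym/eqP.
  rewrite mulf_eq0 => /orP[/eqP y20|/eqP //].
  have := le_max_height 1 y2; rewrite y20 /height /= re_antipode; lra.
apply: max_height_eq0; have := H y1; rewrite w0 mulr0 {1}/height /= re_antipode divr1.
by move=> /eqP; rewrite mulf_eq0 => /orP[/eqP //|/eqP]; lra.
Qed.

Definition cube_map (D : topologicalZmodType) m (v : 'rV[R]_m) : zprod torus D :=
  ((fun k => if insub k is Some j then arc (v ord0 j) else 0), 0).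

Lemma cube_map_continuous D m : continuous (@cube_map D m).
Proof.
apply: (@continuous_pair _ _ _ _ id _ _ (fun=> cvg_id)); last exact: cst_continuous.
apply: continuous_prod => k; case: insubP => [j _ _|_]; last exact: cst_continuous.
move=> v; apply: (@continuous_comp _ _ _ (fun v : 'rV[R]_m => v ord0 j) (@arc R)).
  exact: matrix_normedtype.coord_continuous.
exact: arc_continuous.
Qed.

Lemma cube_map_inj D m (x y : 'rV[R]_m) :
  (forall z, twist D (cube_map D y - cube_map D x, z) =
             twist D (z, cube_map D y - cube_map D x)) ->
  x = y.
Proof.
move=> /twist_symmetric /= /eqP; rewrite subr_eq0 => /eqP yx.
apply/rowP => j; have := congr1 (fun f : torus => f j) yx.
by rewrite /= valK => /arc_inj.
Qed.

(** The discrete cyclic factor of order [n.+1] provides the [n.+1] connected components. *)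
Definition loop (n : nat) : topMetagroupType :=
  ext (twist (discrete_topology 'I_n.+1)).

Lemma loop_not_decomposed n : ~ exists S : inverse_system,
  (forall j : sys_index S, finite_covering_dim (sys_obj j)) /\ decomposed (loop n) S.
Proof.
(* The closed left half of the circle serves as the compact set met by the multiples of every
   nonzero element. *)
apply: (@not_decomposed _ _ _ [set z : circle R | re z <= 0] _ _ _ _ R
  (@cube_map (discrete_topology 'I_n.+1))).
- exact: circle_accessible.
- rewrite -[mkset _]setTI; apply: compact_closedI; first exact: circle_compact.
  apply: (@preimage_closed _ _ (@re R) [set a | a <= 0]); last exact: closed_le.
  by move=> z _; exact: re_continuous.
- by rewrite /= re0 ler10.
- by move=> z /circle_no_small_subgroup[k]; exists k.
- by move=> m; exact: cube_map_continuous.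
- by move=> m x y _ _; exact: cube_map_inj.
Qed.

Lemma discrete_locally_path_connected (D : choiceType) :
  locally_path_connected R (discrete_topology D).
Proof.
move=> x U /nbhs_singleton Ux; exists [set x]; split; first exact: discrete_set1.
  by move=> _ ->.
exact: path_connected1.
Qed.

Lemma torus_path_connected : path_connected R [set: torus].
Proof.
have := @path_connected_prod R nat (fun=> circle R) (fun=> setT)
  (fun=> @circle_path_connected R).
by rewrite (_ : mkset _ = setT) //; apply/seteqP; split.
Qed.

Lemma loop_locally_connected n : locally_connected (loop n).
Proof.
apply: (@locally_path_connectedW R).
apply: (@locally_path_connected_setX R (circle R)
  (zprod torus (discrete_topology 'I_n.+1))).
  exact: circle_locally_path_connected.
apply: (@locally_path_connected_setX R torus (discrete_topology 'I_n.+1)).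
  apply: locally_path_connected_prod => _; first exact: circle_path_connected.
  exact: circle_locally_path_connected.
exact: discrete_locally_path_connected.
Qed.

Lemma loop_compact n : compact [set: loop n].
Proof.
rewrite (_ : setT = [set: circle R] `*`
  ([set: torus] `*` [set: discrete_topology 'I_n.+1])).
  apply: compact_setX; first exact: circle_compact.
  apply: compact_setX.
    have := @tychonoff nat (fun=> circle R) (fun=> setT) (fun=> @circle_compact R).
    by rewrite (_ : mkset _ = setT) //; apply/seteqP; split.
  by apply: finite_compact; exact: (@finite_finset 'I_n.+1).
by apply/seteqP; split.
Qed.

Lemma loop_component_continuous n : continuous (fun g : loop n => g.2.2).
Proof.
move=> g; apply: (@continuous_comp _ _ _ (fun g : loop n => g.2) (fun p => p.2)).
  exact: ext_snd_continuous.
exact: cvg_snd.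
Qed.

Lemma loop_accessible n : @accessible_space (loop n).
Proof.
apply: accessible_separating => -[a [x i]] [b [y j]] ne.
have [ab|ab] := pselect (a = b); last first.
  exists (circle R), (fun g => g.1); split=> //; first exact: circle_accessible.
  exact: ext_fst_continuous.
have [xy|xy] := pselect (x = y); last first.
  have [k xyk] : exists k, x k <> y k.
    apply: contrapT => /forallNP xyk; apply: xy.
    by apply: functional_extensionality_dep => k; apply: contrapT; exact: xyk.
  exists (circle R), (fun g : loop n => g.2.1 k).
  split=> //; first exact: circle_accessible.
  move=> g; apply: (@continuous_comp _ _ _ (fun g : loop n => g.2) (fun p => p.1 k)).
    exact: ext_snd_continuous.
  exact: continuous_comp_fst (@torus_coord_continuous k) _.
exists (discrete_topology 'I_n.+1), (fun g : loop n => g.2.2); split.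
- by apply: hausdorff_accessible; exact: discrete_hausdorff.
- exact: loop_component_continuous.
- by move=> /= ij; apply: ne; rewrite ab xy ij.
Qed.

Lemma loop_component_connected n (i : 'I_n.+1) :
  connected [set g : loop n | g.2.2 = i].
Proof.
apply: (@path_connected_connected R).
have := path_connected_setX (@circle_path_connected R)
  (path_connected_setX torus_path_connected
    (@path_connected1 R (discrete_topology 'I_n.+1) i)).
rewrite (_ : _ `*` _ = [set g : loop n | g.2.2 = i]) //.
by apply/seteqP; split=> [[a [x k]] [_ [_ /=]]|[a [x k]] /=].
Qed.

(** Each component of [loop n] is sent by [psi] to one of the [m.+1] components of [loop m].
    Distinct ones stay distinct, since [phi] maps a connected set into a single component. *)
Lemma loop_iso_le m n : top_iso (loop m) (loop n) -> (n <= m)%N.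
Proof.
move=> [phi [psi [phiK psiK [_ phic] _]]].
pose point (l : 'I_n.+1) : loop n := (0, (0, l)).
pose kappa (l : 'I_n.+1) := (psi (point l)).2.2 : 'I_m.+1.
suff /leq_card : injective kappa by rewrite !card_ord.
move=> l l' ll'.
have := @connected_discrete (loop m) (discrete_topology 'I_n.+1) (fun g => (phi g).2.2)
  [set g | g.2.2 = kappa l] (psi (point l)) (psi (point l')).
rewrite /= !psiK; apply=> //; last exact: loop_component_connected.
move=> g; apply: (@continuous_comp _ _ _ phi (fun g : loop n => g.2.2)).
  exact: phic.
exact: loop_component_continuous.
Qed.

End torus.

Theorem theorem3p25 :
  exists (I : Type) (F : I -> topMetagroupType),
    infinite_set [set: I] /\
    (forall i j : I, top_iso (F i) (F j) -> i = j) /\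
    (forall i : I,
      @accessible_space (F i) /\
      compact [set: F i] /\
      locally_connected (F i) /\
      ~ (exists S : inverse_system,
           (forall j : sys_index S, finite_covering_dim (sys_obj j)) /\
           decomposed (F i) S)).
Proof.
exists nat, (@loop Rdefinitions.R); split; first exact: infinite_nat.
split=> [i j ij|i].
  apply/eqP; rewrite eqn_leq (loop_iso_le ij) andbT.
  apply: (@loop_iso_le Rdefinitions.R).
  by have [phi [psi [? ? ? ?]]] := ij; exists psi, phi.
split; first exact: loop_accessible.
split; first exact: loop_compact.
split; [exact: loop_locally_connected|exact: loop_not_decomposed].
Qed.
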